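(* For all $t\ge0$ and $j,n\in S$ we have $$p_{j,n}(t)=e^{-\xi t}\left[\widehat p_{j,n}(t)-\widehat p_{r,n}(t)\right]+q_n\sum_{k=n}^{+\infty}p^*_{r,k}(t)+p^*_{r,n}(t)\sum_{k=n+1}^{+\infty}q_k.$$
   Context: Let $r$ be a nonnegative integer, $S=\{r,r+1,r+2,\ldots\}$, and let $\alpha_n>0$ ($n\ge r$), $\beta_n\ge 0$ ($n\ge r+1$), $\xi>0$ be constants. $\{N(t);t\ge 0\}$ is the continuous-time Markov chain on $S$ (birth-death process with catastrophes) with transitions: $n\to n+1$ with rate $\alpha_n$ for $n\ge r$; $n\to n-1$ with rate $\beta_n$ for $n\ge r+2$; $r+1\to r$ with rate $\beta_{r+1}+\xi$; $n\to r$ with rate $\xi$ for $n\ge r+2$. Its transition probabilities are $p_{j,n}(t)=\Pr\{N(t)=n\mid N(0)=j\}$. $\{\widehat N(t);t\ge0\}$ is the birth-death process on $S$ with the same birth rates $\alpha_n$ and death rates $\beta_n$ but without catastrophes ($\xi$ replaced by $0$); its transition probabilities are $\widehat p_{j,n}(t)=\Pr\{\widehat N(t)=n\mid\widehat N(0)=j\}$, and it is assumed non-explosive: $\sum_{n\ge r}\widehat p_{j,n}(t)=1$ for all $j\in S$, $t\ge0$. $N(t)$ has a steady-state distribution $q_n=\lim_{t\to+\infty}p_{j,n}(t)$, $n\in S$ (independent of $j$, with $\sum_{n\ge r}q_n=1$). $\{N^*(t);t\ge0\}$ is the time-homogeneous birth-death process on $S$, with $r$ a reflecting state, having birth and death rates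 $$\alpha_n^*=\alpha_n\,\frac{\sum_{k=n}^{+\infty}q_k}{\sum_{k=n+1}^{+\infty}q_k}\quad(n\ge r),\qquad \beta_n^*=\beta_n\,\frac{\sum_{k=n+1}^{+\infty}q_k}{\sum_{k=n}^{+\infty}q_k}\quad(n>r),$$ and started from $\Pr\{N^*(0)=r\}=1$; $p^*_{r,n}(t)=\Pr\{N^*(t)=n\mid N^*(0)=r\}$.
   Formalization: The formal theorem additionally assumes that N* started at r is non-explosive (the p*_{r,n}(t) sum to 1 over n); without it the identity fails, e.g. for α_n=1, β_n=n!, where N* explodes and summing over n with j=r gives 1<1. *)

(* Defs.v *)
From HB Require Import structures.
From mathcomp Require Import all_boot all_order all_algebra.
From mathcomp Require Import all_classical all_reals all_analysis.
Set Implicit Arguments.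
Unset Strict Implicit.
Unset Printing Implicit Defensive.
Import Order.TTheory GRing.Theory Num.Theory.
Import numFieldNormedType.Exports.
Local Open Scope classical_set_scope.
Local Open Scope ring_scope.

(** Continuous-time Markov chains on the state space S = {r, r+1, ...}.
    A state is an [n : nat] with [r <= n]; values at states below [r] or at
    negative times are never used. [p i n t] stands for
    Pr{N(t) = n | N(0) = i}, and [a i n] (n != i) for the rate of the
    transition i -> n. *)

(* Only applied to summable sequences of nonnegative reals. *)
Definition tail (R : realType) (u : nat -> R) (n : nat) : R :=
  fine (\sum_(n <= k <oo) (u k)%:E)%E.

Definition exit_rate (R : realType) (r : nat) (a : nat -> nat -> R)
    (i : nat) : R :=
  fine (\sum_(r <= k <oo | k != i) (a i k)%:E)%E.

(* The conservative Q-matrix of the rates [a]. *)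
Definition generator (R : realType) (r : nat) (a : nat -> nat -> R)
    (i n : nat) : R :=
  if n == i then - exit_rate r a i else a i n.

(* Row sums may be smaller than 1: the defect is the probability that the
   chain has exploded before time t. *)
Record transition_function (R : realType) (r : nat) (a : nat -> nat -> R)
    (p : nat -> nat -> R -> R) : Prop := TransitionFunction {
  tf_ge0 : forall (i n : nat) (t : R), (r <= i)%N -> (r <= n)%N -> 0 <= t ->
    0 <= p i n t;
  tf_le1 : forall (i : nat) (t : R), (r <= i)%N -> 0 <= t ->
    (\sum_(r <= n <oo) (p i n t)%:E <= 1)%E;
  tf_init : forall i n : nat, (r <= i)%N -> (r <= n)%N ->
    p i n 0 = (n == i)%:R;
  tf_chapman_kolmogorov : forall (i n : nat) (s t : R),
    (r <= i)%N -> (r <= n)%N -> 0 <= s -> 0 <= t ->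
    ((p i n (s + t))%:E = \sum_(r <= k <oo) (p i k s * p k n t)%:E)%E;
  tf_rates : forall i n : nat, (r <= i)%N -> (r <= n)%N ->
    (p i n h - (n == i)%:R) / h @[h --> 0^'+] --> generator r a i n }.

(* The transition rates alone determine the chain only up to its first
   explosion. As usual, the chain with rates [a] is the minimal one, which is
   killed at explosion; every other chain with the same rates dominates it. *)
Definition markov_chain (R : realType) (r : nat) (a : nat -> nat -> R)
    (p : nat -> nat -> R -> R) : Prop :=
  transition_function r a p /\
  forall p' : nat -> nat -> R -> R, transition_function r a p' ->
    forall (i n : nat) (t : R), (r <= i)%N -> (r <= n)%N -> 0 <= t ->
      p i n t <= p' i n t.

Definition nonexplosive_from (R : realType) (r : nat)
    (p : nat -> nat -> R -> R) (i : nat) : Prop :=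
  forall t : R, 0 <= t -> (\sum_(r <= n <oo) (p i n t)%:E = 1)%E.

(* The transition r+1 -> r gathers a death and a catastrophe, and there are
   neither deaths nor catastrophes at [r]. *)
Definition catastrophe_rates (R : realType) (r : nat) (alpha beta : nat -> R)
    (xi : R) (i n : nat) : R :=
  (if n == i.+1 then alpha i else 0) +
  (if (r < i)%N && (i == n.+1) then beta i else 0) +
  (if (r < i)%N && (n == r) then xi else 0).

Definition birth_death_rates (R : realType) (r : nat) (alpha beta : nat -> R) :
    nat -> nat -> R :=
  catastrophe_rates r alpha beta 0.

Definition steady_state (R : realType) (r : nat) (p : nat -> nat -> R -> R)
    (q : nat -> R) : Prop :=
  (forall j n : nat, (r <= j)%N -> (r <= n)%N ->
    p j n t @[t --> +oo] --> q n) /\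
  (\sum_(r <= n <oo) (q n)%:E = 1)%E.

Definition alpha_star (R : realType) (alpha q : nat -> R) (n : nat) : R :=
  alpha n * (tail q n / tail q n.+1).

Definition beta_star (R : realType) (beta q : nat -> R) (n : nat) : R :=
  beta n * (tail q n.+1 / tail q n).

(* Main.v *)
(** The chain with rates [a] is the increasing limit of its truncations to
    [0, m - 1], whose transition matrices are matrix exponentials; hence its
    rows are dominated by every nonnegative supersolution of the forward
    equations.  Put [Q n = \sum_(k >= n) q k] and
    [G n t = \sum_(k >= n) pstar r k t].  The rates of [N^*] are exactly those
    for which [Q n * G n] solves the forward equation for the tails of the
    chain with catastrophes started at [r], so its increments
    [w n = Q n * G n - Q n.+1 * G n.+1 = q n * G n + pstar r n * Q n.+1]
    solve the forward equations of that chain.  Consequently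
    [expR (xi * t) * w] is a supersolution for the birth-death chain and
    dominates [phat r], which makes
    [v = expR (- xi * t) * (phat j - phat r) + w] nonnegative.  Now [v] solves
    the forward equations of the chain with catastrophes started at [j] and
    has total mass 1, so it dominates [p j]; as [p j] also has mass 1, the two
    coincide. *)

Require Import Defs.
From mathcomp Require Import all_boot all_order all_algebra.
From mathcomp Require Import all_classical all_reals all_analysis.
From mathcomp Require Import ring lra zify.
Import Order.TTheory GRing.Theory Num.Theory.
Import numFieldNormedType.Exports.
Local Open Scope ring_scope.
Local Open Scope classical_set_scope.
Set Implicit Arguments.
Unset Strict Implicit.

(** * Derivatives on the half line and a comparison principle for linear systems *)

Section Calculus.
Context {R : realType}.
Implicit Types (f g df : R -> R) (a b c t : R).

Lemma is_derive_sum_ord m (h dh : nat -> R -> R) t :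
  (forall k, (k < m)%N -> is_derive t 1 (h k) (dh k t)) ->
  is_derive t 1 (fun s => \sum_(k < m) h k s) (\sum_(k < m) dh k t).
Proof.
move=> H.
have -> : (fun s => \sum_(k < m) h k s) = \sum_(k < m) h k.
  by apply/funext => s; rewrite fct_sumE.
by apply: is_derive_sum => k; exact: H.
Qed.

Lemma is_derive_funD f g a b t : is_derive t 1 f a -> is_derive t 1 g b ->
  is_derive t 1 (fun s => f s + g s) (a + b).
Proof. exact: is_deriveD. Qed.

Lemma is_derive_funB f g a b t : is_derive t 1 f a -> is_derive t 1 g b ->
  is_derive t 1 (fun s => f s - g s) (a - b).
Proof. exact: is_deriveB. Qed.

Lemma is_derive_funM f g a b t : is_derive t 1 f a -> is_derive t 1 g b ->
  is_derive t 1 (fun s => f s * g s) (a * g t + f t * b).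
Proof.
by move=> fa gb; rewrite addrC [a * _]mulrC; exact: is_deriveM.
Qed.

Lemma is_derive_funZ c f a t : is_derive t 1 f a ->
  is_derive t 1 (fun s => c * f s) (c * a).
Proof. exact: is_deriveZ. Qed.

Lemma is_derive_const (c t : R) : is_derive t 1 (fun _ : R => c) 0.
Proof. exact: is_derive_cst. Qed.

Lemma is_derive_at_right (f : R -> R) (a t : R) : is_derive t 1 f a ->
  (f (t + h) - f t) / h @[h --> 0^'+] --> a.
Proof.
move=> [df <-]; have : (fun h => h^-1 *: ((f \o shift t) (h *: 1) - f t)) @ 0^'
    --> 'D_1 f t by exact: df.
move=> /cvg_dnbhs_at_right.
rewrite (_ : (fun h => _) = (fun h => (f (t + h) - f t) / h)) //.
by apply/funext => h; rewrite /= /GRing.scale/= mulr1 [h + t]addrC mulrC.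
Qed.

Lemma is_derive_exprn n t :
  is_derive t 1 (fun s : R => s ^+ n.+1) (n.+1%:R * t ^+ n).
Proof.
have -> : (fun s : R => s ^+ n.+1) = (id : R -> R) ^+ n.+1.
  by apply/funext => s; rewrite exprfctE.
apply: is_derive_eq (is_deriveX n.+1 (is_derive_id t 1)) _.
by rewrite /GRing.scale/= mulr1.
Qed.

Lemma is_derive_expRM c t :
  is_derive t 1 (fun s => expR (c * s)) (c * expR (c * t)).
Proof.
have H : is_derive t 1 (fun s : R => c * s) (c * 1) by exact: is_deriveZ.
have := @is_derive1_comp R expR _ t _ _ (is_derive_expR (c * t)) H.
by rewrite mulr1 [_ * c]mulrC.
Qed.

Lemma cvg_expRM_at_right0 c : expR (c * s) @[s --> 0^'+] --> expR (c * 0).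
Proof.
apply: cvg_at_right_filter.
apply: (@continuous_cvg _ _ _ _ _ _ expR); first exact: continuous_expR.
by apply: cvgM; [exact: cvg_cst | exact: cvg_id].
Qed.

(** Chains are controlled only at nonnegative times: derivatives at positive times and a right limit
    at 0, which together suffice for the mean value theorem from 0 on. *)
Lemma continuous_within0 f df b : 0 < b ->
  (forall t, 0 < t -> is_derive t 1 f (df t)) ->
  f s @[s --> 0^'+] --> f 0 -> {within `[0, b], continuous f}.
Proof.
move=> b0 fdf f0.
have cf t : 0 < t -> {for t, continuous f}.
  move=> t0; apply: differentiable_continuous.
  by apply/derivable1_diffP; have [] := fdf t t0.
apply/continuous_within_itvP => //; split => //.
  by move=> t; rewrite in_itv/= => /andP[t0 _]; exact: cf.
by apply: cvg_at_left_filter; exact: cf.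
Qed.

Lemma MVT0 f df a b : 0 <= a -> a < b ->
  (forall t, 0 < t -> is_derive t 1 f (df t)) ->
  f s @[s --> 0^'+] --> f 0 ->
  exists2 c, a < c < b & f b - f a = df c * (b - a).
Proof.
move=> a0 ab fdf f0.
have [||c cab ->] := @MVT R f df a b ab.
- move=> t; rewrite in_itv/= => /andP[at_ _].
  by apply: fdf; exact: le_lt_trans at_.
- have := continuous_within0 (le_lt_trans a0 ab) fdf f0.
  by apply: continuous_subspaceW; apply: subset_itvr; rewrite bnd_simp.
- by exists c.
Qed.

Lemma derive_ge0_le f df t : 0 <= t ->
  (forall t, 0 < t -> is_derive t 1 f (df t)) ->
  f s @[s --> 0^'+] --> f 0 ->
  (forall s, 0 < s < t -> 0 <= df s) -> f 0 <= f t.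
Proof.
rewrite le_eqVlt => /predU1P[<-//|t0] fdf f0 df0.
have [c ct H] := MVT0 (lexx 0) t0 fdf f0.
by rewrite -subr_ge0 H subr0 mulr_ge0 ?df0// ltW.
Qed.

Lemma cvg_powfact0 b c : c * (b ^+ n / n`!%:R) @[n --> \oo] --> (0 : R).
Proof.
rewrite -[X in _ --> X](mulr0 c); apply: cvgM; first exact: cvg_cst.
exact: (cvg_series_cvg_0 (@is_cvg_series_exp_coeff R b)).
Qed.

Lemma cvgn_le (u : nat -> R) (l c : R) :
  u m @[m --> \oo] --> l -> (forall m, u m <= c) -> l <= c.
Proof.
by move=> ul uc; apply: (ler_cvg_to ul (cvg_cst c)); exact: nearW.
Qed.

Lemma cvgn_ge (u : nat -> R) (l c : R) N :
  u m @[m --> \oo] --> l -> (forall m, (N <= m)%N -> c <= u m) -> c <= l.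
Proof.
by move=> ul uc; apply: (ler_cvg_to (cvg_cst c) ul); exists N.
Qed.

(* After the change of unknown [z = e^{ct} x] with [c] large all coefficients
   are nonnegative, so a lower bound [- K] on [0, T] improves inductively to
   [- K (b t)^n / n!]. *)
Lemma linear_system_ge0 m (A : nat -> nat -> R) (x dx : nat -> R -> R) :
  (forall k j, k != j -> 0 <= A k j) ->
  (forall j t, (j < m)%N -> 0 < t -> is_derive t 1 (x j) (dx j t)) ->
  (forall j t, (j < m)%N -> 0 < t ->
    \sum_(k < m) x k t * A k j <= dx j t) ->
  (forall j, (j < m)%N -> x j s @[s --> 0^'+] --> x j 0) ->
  (forall j, (j < m)%N -> 0 <= x j 0) ->
  forall j t, (j < m)%N -> 0 <= t -> 0 <= x j t.
Proof.
move=> A0 xdx xA x0c x00 j0 T jm0; rewrite le_eqVlt => /predU1P[<-|T0].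
  exact: x00.
pose c := \sum_(k < m) `|A k k|.
pose B k j := A k j + c *+ (k == j).
have B0 k j : (k < m)%N -> 0 <= B k j.
  move=> km; rewrite /B; have [<-|kj] := eqVneq k j; last by rewrite addr0 A0.
  rewrite mulr1n -lerBlDl sub0r /c (bigD1 (Ordinal km))//=.
  by rewrite ler_wpDr ?sumr_ge0// -normrN ler_norm.
pose b := \sum_(j < m) \sum_(k < m) B k j.
have Bb j : (j < m)%N -> \sum_(k < m) B k j <= b.
  move=> jm; rewrite /b [leRHS](bigD1 (Ordinal jm))//= ler_wpDr// sumr_ge0// => i _.
  by apply: sumr_ge0 => k _; exact: B0.
have b0 : 0 <= b by apply: sumr_ge0 => i _; apply: sumr_ge0 => k _; exact: B0.
pose z j t := expR (c * t) * x j t.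
pose dz j t := c * expR (c * t) * x j t + expR (c * t) * dx j t.
have zdz j t : (j < m)%N -> 0 < t -> is_derive t 1 (z j) (dz j t).
  move=> jm t0; have H1 := is_derive_expRM c t; have H2 := xdx j t jm t0.
  exact: is_derive_funM H1 H2.
have zB j t : (j < m)%N -> 0 < t -> \sum_(k < m) z k t * B k j <= dz j t.
  move=> jm t0; rewrite /B; under eq_bigr do rewrite mulrDr.
  rewrite big_split/= /dz addrC lerD//.
    rewrite (bigD1 (Ordinal jm))//= eqxx big1 ?addr0.
      by rewrite mulr1n /z mulrC mulrA.
    move=> i; rewrite -val_eqE/= => /negbTE ->; by rewrite mulr0n mulr0.
  under eq_bigr do rewrite /z -mulrA.
  by rewrite -mulr_sumr ler_wpM2l ?expR_ge0// xA.
have z0c j : (j < m)%N -> z j s @[s --> 0^'+] --> z j 0.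
  by move=> jm; apply: cvgM; [exact: cvg_expRM_at_right0|exact: x0c].
(* Each [z j] attains a minimum on the compact interval; the sum of the absolute values of these
   minima serves for all [j] at once. *)
have [K K0 zK] : exists2 K, 0 <= K &
    forall j t, (j < m)%N -> 0 <= t <= T -> - K <= z j t.
  have Hj j : exists K, 0 <= K /\
      ((j < m)%N -> forall t, 0 <= t <= T -> - K <= z j t).
    have [jm|] := boolP (j < m)%N; last by exists 0.
    have H := continuous_within0 T0 (zdz j ^~ jm) (z0c j jm).
    have [d dT dmin] := EVT_min (ltW T0) H.
    exists `|z j d|; split=> // _ t tT.
    by apply: le_trans (dmin t _); rewrite ?in_itv// lerNnormlW.
  have [K HK] := boolp.choice Hj.
  exists (\sum_(j < m) K j) => [|j t jm tT].
    by apply: sumr_ge0 => i _; have [] := HK i.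
  have [_ /(_ jm t tT)] := HK j; apply: le_trans.
  rewrite lerN2 (bigD1 (Ordinal jm))//= ler_wpDr// sumr_ge0// => i _.
  by have [] := HK i.
have zn n j t : (j < m)%N -> 0 <= t <= T ->
    - K * ((b * t) ^+ n / n`!%:R) <= z j t.
  elim: n j t => [|n IHn] j t jm /andP[t0 tT].
    by rewrite expr0 fact0 divr1 mulr1 zK// t0.
  (* [y] is the gap between the two sides of the claim; its derivative is nonnegative because the
     induction hypothesis bounds every [z k] in [zB]. *)
  pose y s := z j s + K * b ^+ n.+1 / n.+1`!%:R * s ^+ n.+1.
  pose dy s := dz j s + K * b * ((b * s) ^+ n / n`!%:R).
  rewrite -subr_ge0 (_ : _ - _ = y t); last first.
    by rewrite /y exprMn; ring.
  have y0 : 0 <= y 0.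
    rewrite /y expr0n/= mulr0 addr0 /z mulr0 expR0 mul1r; exact: x00.
  apply: le_trans y0 _; apply: (@derive_ge0_le y dy) => //.
  - move=> s s0; have H1 := zdz j s jm s0.
    have H2 := is_derive_funZ (K * b ^+ n.+1 / n.+1`!%:R) (is_derive_exprn n s).
    apply: is_derive_eq (is_derive_funD H1 H2) _.
    rewrite /dy; congr (_ + _); rewrite factS natrM.
    rewrite exprMn exprS.
    have : n.+1%:R != 0 :> R by rewrite pnatr_eq0.
    have : n`!%:R != 0 :> R by rewrite pnatr_eq0 -lt0n fact_gt0.
    move: (n.+1%:R : R) (n`!%:R : R) => u v v0 u0.
    by field; rewrite u0 v0.
  - apply: cvgD; first exact: z0c.
    apply: cvgM; first exact: cvg_cst.
    by apply: cvg_at_right_filter; apply: exprn_continuous.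
  - move=> s /andP[s0 st]; rewrite /dy -lerBlDr sub0r.
    apply: le_trans (zB j s jm s0).
    rewrite [K * b * _]mulrAC -mulNr.
    have P0 : 0 <= (b * s) ^+ n / n`!%:R.
      by rewrite divr_ge0// exprn_ge0// mulr_ge0// ltW.
    rewrite -mulNr (le_trans (y := \sum_(k < m) (- K * ((b * s) ^+ n / n`!%:R)) * B k j))//.
      rewrite -mulr_sumr ler_wnM2l ?Bb//.
      by rewrite mulNr oppr_le0 mulr_ge0.
    apply: ler_sum => k _; rewrite ler_wpM2r ?B0//.
    by apply: IHn => //; rewrite (ltW s0) (le_trans (ltW st)).
have : 0 <= z j0 T.
  apply: (ler_cvg_to (cvg_powfact0 (b * T) (- K)) (cvg_cst (z j0 T))).
  by apply: nearW => n; apply: zn => //; rewrite lexx ltW.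
by rewrite /z pmulr_rge0// expR_gt0.
Qed.
End Calculus.

(** * Exponentials of finite truncations of an infinite matrix *)

Section TruncatedExponential.
Context {R : realType}.
Implicit Types (A : nat -> nat -> R) (m i j k l : nat) (s t : R).

Lemma cvg_sum_ord {T : Type} (F : set_system T) {FF : Filter F} m
    (u : nat -> T -> R) (l : nat -> R) :
  (forall k, (k < m)%N -> u k x @[x --> F] --> l k) ->
  \sum_(k < m) u k x @[x --> F] --> \sum_(k < m) l k.
Proof.
move=> H; apply: cvg_big => [|i _]; last exact: H.
by apply: add_continuous.
Qed.

(* The entries of [A ^+ k] for the restriction of [A] to the states
   [0, ..., m - 1]; only the values with [j < m] matter. *)
Fixpoint mpow A m k i j : R :=
  if k is k'.+1 then \sum_(l < m) mpow A m k' i l * A l j else (j == i)%:R.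

(** Entries of the exponential of [t] times the truncated matrix, as a power series in [t] so that
    termwise differentiation applies. *)
Definition mexp A m i j t : R :=
  limn (pseries (fun k => mpow A m k i j / k`!%:R) t).

Lemma mpow_bound A m i : exists b, 0 <= b /\
  forall k j, (j < m)%N -> `|mpow A m k i j| <= b ^+ k.
Proof.
exists (\sum_(j < m) \sum_(l < m) `|A l j|); split.
  by apply: sumr_ge0 => j _; apply: sumr_ge0.
elim=> [|k IHk] j jm /=; first by rewrite expr0; case: eqP => _;
  rewrite ?normr1 ?normr0.
rewrite exprSr (le_trans (ler_norm_sum _ _ _))//.
apply: (@le_trans _ _ (\sum_(l < m)
    (\sum_(j < m) \sum_(l < m) `|A l j|) ^+ k * `|A l j|)).
  by apply: ler_sum => l _; rewrite normrM ler_wpM2r// IHk.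
rewrite -mulr_sumr ler_wpM2l//.
  by apply: exprn_ge0; apply: sumr_ge0 => ? _; apply: sumr_ge0.
rewrite [leRHS](bigD1 (Ordinal jm))//= ler_wpDr// sumr_ge0// => ? _.
exact: sumr_ge0.
Qed.

Lemma is_cvg_pseries_fact (a : nat -> R) b c t : 0 <= b -> 0 <= c ->
  (forall k, `|a k| <= c * b ^+ k) ->
  cvgn (pseries (fun k => a k / k`!%:R) t).
Proof.
move=> b0 c0 ab; apply: normed_cvg.
have H : cvgn (series (c *: exp_coeff (b * `|t|))).
  by apply: is_cvg_seriesZ; exact: is_cvg_series_exp_coeff.
apply: series_le_cvg H => n; first exact: normr_ge0.
  change (0 <= c * ((b * `|t|) ^+ n / n`!%:R)).
  by rewrite mulr_ge0// divr_ge0// exprn_ge0// mulr_ge0.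
change (`|a n / n`!%:R * t ^+ n| <= c * ((b * `|t|) ^+ n / n`!%:R)).
rewrite !normrM normfV normrX [`|n`!%:R|]ger0_norm//.
rewrite [leRHS](_ : _ = c * b ^+ n / n`!%:R * `|t| ^+ n); last first.
  by rewrite exprMn; ring.
by rewrite ler_wpM2r ?exprn_ge0// ler_wpM2r// invr_ge0.
Qed.

Lemma is_derive_mexp A m i j t : (j < m)%N ->
  is_derive t 1 (mexp A m i j) (\sum_(l < m) mexp A m i l t * A l j).
Proof.
move=> jm; have [b [b0 Hb]] := mpow_bound A m i.
(* With coefficients [a k / k!], formal differentiation only shifts [a]. *)
have D (a : nat -> R) : pseries_diffs (fun k => a k / k`!%:R) =
    (fun k => a k.+1 / k`!%:R).
  apply/funext => k; rewrite /pseries_diffs factS natrM.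
  have : k.+1%:R != 0 :> R by rewrite pnatr_eq0.
  have : k`!%:R != 0 :> R by rewrite pnatr_eq0 -lt0n fact_gt0.
  by move: (k.+1%:R : R) (k`!%:R : R) => u v v0 u0; field; rewrite u0 v0.
have C l x : (l < m)%N -> cvgn (pseries (fun k => mpow A m k i l / k`!%:R) x).
  move=> lm; apply: (@is_cvg_pseries_fact (fun k => mpow A m k i l) _ _ _ b0 ler01) => k.
  by rewrite mul1r Hb.
(* A radius beyond [|t|], at which the series and its first two formal derivatives converge. *)
pose K := `|t| + 1.
have tK : `|t| < `|K| by rewrite [ltRHS]ger0_norm ?addr_ge0// ltrDl.
have H1 : cvgn (pseries (fun k => mpow A m k.+1 i j / k`!%:R) K).
  by apply: (@is_cvg_pseries_fact (fun k => mpow A m k.+1 i j) _ _ _ b0 b0) => k;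
    rewrite -exprS Hb.
have H2 : cvgn (pseries (fun k => mpow A m k.+2 i j / k`!%:R) K).
  apply: (@is_cvg_pseries_fact (fun k => mpow A m k.+2 i j) _ _ _ b0 (exprn_ge0 2 b0)) => k.
  by rewrite -exprD Hb.
have := @pseries_snd_diffs _ (fun k => mpow A m k i j / k`!%:R) K t (C j K jm).
rewrite !D => /(_ H1 H2 tK) H; apply: is_derive_eq H _.
apply/cvg_lim => //.
have -> : pseries (fun k => mpow A m k.+1 i j / k`!%:R) t =
    fun n => \sum_(l < m) pseries (fun k => mpow A m k i l / k`!%:R) t n * A l j.
  apply/funext => n; rewrite /pseries/series/=.
  under [RHS]eq_bigr do rewrite mulr_suml.
  rewrite [RHS]exchange_big/=; apply: eq_bigr => k _.
  by rewrite !mulr_suml; apply: eq_bigr => l _; ring.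
apply: (@cvg_sum_ord _ _ _ m
  (fun l n => pseries (fun k => mpow A m k i l / k`!%:R) t n * A l j)
  (fun l => mexp A m i l t * A l j)) => l lm.
by apply: cvgM; [exact: C | exact: cvg_cst].
Qed.

Lemma mexp0 A m i j : mexp A m i j 0 = (j == i)%:R.
Proof.
apply/cvg_lim => //; rewrite -(cvg_shiftn 1).
(* The empty partial sum is 0; after the shift by one the partial sums at time 0 are constant. *)
rewrite [X in X @ _ --> _](_ : _ = fun=> (j == i)%:R); first exact: cvg_cst.
apply/funext => n; rewrite /= addn1 /pseries/series/= big_nat_recl//=.
rewrite expr0 fact0 divr1 mulr1 big1_seq ?addr0// => k _.
by rewrite exprS mul0r mulr0.
Qed.

Lemma mexp_cvg0 A m i j : (j < m)%N ->
  mexp A m i j s @[s --> 0^'+] --> mexp A m i j 0.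
Proof.
move=> jm; apply: cvg_at_right_filter; apply: differentiable_continuous.
by apply/derivable1_diffP; have [] := @is_derive_mexp A m i j 0 jm.
Qed.
End TruncatedExponential.

(** * Truncations of a conservative Q-matrix *)

Section TruncatedChain.
Context {R : realType}.
Implicit Types (m N i j k l : nat) (s t : R).

Lemma sum_ord_le m N (f : nat -> R) : (m <= N)%N ->
  (forall k, (m <= k)%N -> 0 <= f k) ->
  \sum_(k < m) f k <= \sum_(k < N) f k.
Proof.
move=> mN f0; rewrite -!(big_mkord xpredT) (@big_cat_nat _ _ _ m 0 N)//=.
rewrite lerDl big_nat_cond sumr_ge0// => k /andP[/andP[mk _] _]; exact: f0.
Qed.

Lemma sum_ord_le_supp m N (f : nat -> R) : (forall k, 0 <= f k) ->
  (forall k, (m <= k)%N -> f k = 0) ->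
  \sum_(k < N) f k <= \sum_(k < m) f k.
Proof.
move=> f0 fm; apply: (@le_trans _ _ (\sum_(k < m + N) f k)).
  by apply: sum_ord_le => //; rewrite leq_addl.
rewrite big_split_ord/= [X in _ + X]big1 ?addr0// => k _.
by rewrite fm// leq_addr.
Qed.

(** Partial row sums that are eventually 0 express both finite support of a row and its total 0,
    without any series. *)
Definition qmatrix (Q : nat -> nat -> R) :=
  (forall k j, k != j -> 0 <= Q k j) /\
  (forall i, exists M, forall m, (M <= m)%N -> \sum_(j < m) Q i j = 0).

Context (Q : nat -> nat -> R) (HQ : qmatrix Q).

(** Completing the truncated row to total 0 only adds off-diagonal entries, which are
    nonnegative. *)
Lemma qmatrix_row_le0 m i : (i < m)%N -> \sum_(j < m) Q i j <= 0.
Proof.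
move=> im; have [M HM] := HQ.2 i.
rewrite -[leRHS](HM (maxn m M) (leq_maxr _ _)); apply: sum_ord_le => [|k mk].
  exact: leq_maxl.
by apply: HQ.1; rewrite ltn_eqF// (leq_trans im).
Qed.

Lemma mexp_ge0 m i j t : (j < m)%N -> 0 <= t -> 0 <= mexp Q m i j t.
Proof.
move=> jm t0.
apply: (@linear_system_ge0 _ m Q (mexp Q m i)
  (fun j t => \sum_(l < m) mexp Q m i l t * Q l j)) => //.
- exact: HQ.1.
- by move=> *; exact: is_derive_mexp.
- by move=> *; exact: mexp_cvg0.
- by move=> k _; rewrite mexp0; case: eqP.
Qed.

(** The difference of [w] and the exponential satisfies the same differential inequality with
    nonnegative initial values, so the comparison principle applies. *)
Lemma mexp_le_super m i (w dw : nat -> R -> R) :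
  (forall j t, (j < m)%N -> 0 < t -> is_derive t 1 (w j) (dw j t)) ->
  (forall j t, (j < m)%N -> 0 < t -> \sum_(k < m) w k t * Q k j <= dw j t) ->
  (forall j, (j < m)%N -> w j s @[s --> 0^'+] --> w j 0) ->
  (forall j, (j < m)%N -> (j == i)%:R <= w j 0) ->
  forall j t, (j < m)%N -> 0 <= t -> mexp Q m i j t <= w j t.
Proof.
move=> wdw wQ w0c w0 j t jm t0; rewrite -subr_ge0.
apply: (@linear_system_ge0 _ m Q (fun j t => w j t - mexp Q m i j t)
  (fun j t => dw j t - \sum_(l < m) mexp Q m i l t * Q l j)) => //.
- exact: HQ.1.
- move=> k s km s0; apply: is_derive_funB; first exact: wdw.
  exact: is_derive_mexp.
- move=> k s km s0; under eq_bigr do rewrite mulrBl.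
  by rewrite sumrB lerD2r; exact: wQ.
- by move=> k km; apply: cvgB; [exact: w0c | exact: mexp_cvg0].
- by move=> k km; rewrite subr_ge0 mexp0; exact: w0.
Qed.

(** The larger truncation is a supersolution for the smaller one: it has an additional inflow from
    the states [m] to [N - 1]. *)
Lemma mexp_le m N i j t : (j < m)%N -> (m <= N)%N -> 0 <= t ->
  mexp Q m i j t <= mexp Q N i j t.
Proof.
move=> jm mN t0.
apply: (@mexp_le_super m i (mexp Q N i)
  (fun j t => \sum_(l < N) mexp Q N i l t * Q l j)) => //.
- by move=> k s km s0; apply: is_derive_mexp; exact: leq_trans mN.
- move=> k s km s0; rewrite -!(big_mkord xpredT (fun l => mexp Q N i l s * Q l k)).
  rewrite [leRHS](@big_cat_nat _ _ _ m)//= lerDl big_nat_cond sumr_ge0// => l.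
  rewrite andbT => /andP[ml lN]; rewrite mulr_ge0//.
    by rewrite mexp_ge0// ltW.
  by apply: HQ.1; rewrite gtn_eqF// (leq_trans km).
- by move=> k km; apply: mexp_cvg0; exact: leq_trans mN.
- by move=> k km; rewrite mexp0.
Qed.

Lemma is_derive_mexp_sum m i t :
  is_derive t 1 (fun t => \sum_(j < m) mexp Q m i j t)
    (\sum_(l < m) mexp Q m i l t * \sum_(j < m) Q l j).
Proof.
have H := @is_derive_sum_ord _ m (mexp Q m i)
  (fun j t => \sum_(l < m) mexp Q m i l t * Q l j) t.
apply: is_derive_eq (H _) _; first by move=> k km; exact: is_derive_mexp.
by rewrite exchange_big/=; apply: eq_bigr => l _; rewrite mulr_sumr.
Qed.

Lemma mexp_sum_nincr m i s t : 0 <= s -> s <= t ->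
  \sum_(j < m) mexp Q m i j t <= \sum_(j < m) mexp Q m i j s.
Proof.
move=> s0; rewrite le_eqVlt => /predU1P[->//|st].
have c0 : \sum_(j < m) mexp Q m i j h @[h --> 0^'+] -->
    \sum_(j < m) mexp Q m i j 0.
  by apply: (@cvg_sum_ord _ _ _ _ m (mexp Q m i) (mexp Q m i ^~ 0)) => k km;
    exact: mexp_cvg0.
have [c /andP[sc ct] H] := MVT0 s0 st (fun t _ => is_derive_mexp_sum m i t) c0.
rewrite -subr_le0 H mulr_le0_ge0//; last by rewrite subr_ge0 ltW.
apply: sumr_le0 => l _; rewrite mulr_ge0_le0 ?qmatrix_row_le0//.
by rewrite mexp_ge0// ltW// (le_lt_trans s0).
Qed.

Lemma mexp_sum_le1 m i t : (i < m)%N -> 0 <= t -> \sum_(j < m) mexp Q m i j t <= 1.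
Proof.
move=> im t0; apply: le_trans (mexp_sum_nincr m i (lexx 0) t0) _.
rewrite (bigD1 (Ordinal im))//= mexp0 eqxx big1 ?addr0// => k.
by rewrite mexp0 -val_eqE/= => /negbTE ->.
Qed.

(** Both sides, as functions of [t], solve the same linear system with the same initial values; the
    comparison principle, applied to their difference and to its opposite, gives uniqueness. *)
Lemma mexpD m i j s t : (i < m)%N -> (j < m)%N -> 0 <= t ->
  mexp Q m i j (s + t) = \sum_(k < m) mexp Q m i k s * mexp Q m k j t.
Proof.
move=> im jm t0.
pose x j t := mexp Q m i j (s + t) - \sum_(k < m) mexp Q m i k s * mexp Q m k j t.
pose dx j t := \sum_(l < m) x l t * Q l j.
have xdx k (u : R) : (k < m)%N -> is_derive u 1 (x k) (dx k u).
  move=> km.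
  have H1 : is_derive u 1 (fun u => mexp Q m i k (s + u))
      (\sum_(l < m) mexp Q m i l (s + u) * Q l k).
    have Hs : is_derive u 1 (fun u => s + u) 1.
      by apply: is_derive_eq (is_derive_funD
        (is_derive_cst s u (1 : R)) (is_derive_id u (1 : R))) _;
        rewrite add0r.
    have := @is_derive1_comp R (mexp Q m i k) (fun u => s + u) u _ 1
      (@is_derive_mexp _ Q m i k (s + u) km) Hs.
    by rewrite mulr1.
  have H2 := @is_derive_sum_ord _ m (fun l u => mexp Q m i l s * mexp Q m l k u)
    (fun l u => mexp Q m i l s * \sum_(h < m) mexp Q m l h u * Q h k) u.
  apply: is_derive_eq (is_derive_funB H1 (H2 _)) _.
    by move=> l lm; apply: is_derive_funZ; exact: is_derive_mexp.
  rewrite /dx /x; under [RHS]eq_bigr do rewrite mulrBl.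
  rewrite sumrB; congr (_ - _).
  under eq_bigr do rewrite mulr_sumr.
  rewrite exchange_big/=; apply: eq_bigr => h _; rewrite mulr_suml.
  by apply: eq_bigr => l _; rewrite mulrA.
have cx k : (k < m)%N -> x k h @[h --> 0^'+] --> x k 0.
  move=> km; apply: cvg_at_right_filter; apply: differentiable_continuous.
  by apply/derivable1_diffP; have [] := @xdx k 0 km.
have x0 k : (k < m)%N -> x k 0 = 0.
  move=> km; rewrite /x addr0 (bigD1 (Ordinal km))//= mexp0 eqxx mulr1.
  rewrite big1 ?addr0 ?subrr// => l.
  by rewrite mexp0 -val_eqE/= eq_sym => /negbTE ->; rewrite mulr0.
apply/eqP; rewrite -subr_eq0 -/(x j t) eq_le; apply/andP; split.
  rewrite -oppr_ge0.
  apply: (@linear_system_ge0 _ m Q (fun j t => - x j t) (fun j t => - dx j t)) => //.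
  - exact: HQ.1.
  - move=> k u km _; have := is_derive_funZ (-1) (xdx k u km).
    by rewrite mulN1r; under [X in is_derive _ _ X]eq_fun do rewrite mulN1r.
  - move=> k u km _; rewrite -sumrN; apply: ler_sum => l _; by rewrite mulNr.
  - by move=> k km; apply: cvgN; exact: cx.
  - by move=> k km; rewrite x0// oppr0.
apply: (@linear_system_ge0 _ m Q x dx) => //.
- exact: HQ.1.
- by move=> k u km _; exact: xdx.
- by move=> k km; rewrite x0.
Qed.
End TruncatedChain.

(** * The minimal chain as the limit of its truncations *)

Section MinimalChain.
Context {R : realType} (Q : nat -> nat -> R) (HQ : qmatrix Q).
Implicit Types (m N i j k l : nat) (s t : R).

(** Extension by 0 outside the truncated square, which makes the family increasing in [m] for all
    [i] and [j] at nonnegative times. *)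
Definition trunc m i j t : R :=
  if (i < m)%N && (j < m)%N then mexp Q m i j t else 0.

Definition minchain i j t : R := limn (fun m => trunc m i j t).

Lemma truncE m i j t : (i < m)%N -> (j < m)%N -> trunc m i j t = mexp Q m i j t.
Proof. by rewrite /trunc => -> ->. Qed.

Lemma trunc_out m i j t : (m <= i)%N || (m <= j)%N -> trunc m i j t = 0.
Proof. by rewrite /trunc (leqNgt m i) (leqNgt m j) -negb_and => /negbTE ->. Qed.

Lemma trunc_ge0 m i j t : 0 <= t -> 0 <= trunc m i j t.
Proof.
by move=> t0; rewrite /trunc; case: ifP => // /andP[_ jm]; exact: mexp_ge0.
Qed.

Lemma trunc_nd m N i j t : 0 <= t -> (m <= N)%N -> trunc m i j t <= trunc N i j t.
Proof.
move=> t0 mN; rewrite {1}/trunc; case: ifP => [/andP[im jm]|_]; last exact: trunc_ge0.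
by rewrite truncE ?(leq_trans _ mN)// mexp_le.
Qed.

Lemma sum_trunc_le1 m N i t : 0 <= t -> \sum_(j < N) trunc m i j t <= 1.
Proof.
move=> t0; have [mi|im] := leqP m i.
  by rewrite big1// => j _; rewrite trunc_out// mi.
apply: (@le_trans _ _ (\sum_(j < m) trunc m i j t)).
  apply: (@sum_ord_le_supp R m N (fun j => trunc m i j t)) => j.
    exact: trunc_ge0.
  by move=> mj; rewrite trunc_out// mj orbT.
under eq_bigr do rewrite truncE//.
exact: mexp_sum_le1.
Qed.

Lemma trunc_le1 m i j t : 0 <= t -> trunc m i j t <= 1.
Proof.
move=> t0; apply: le_trans (sum_trunc_le1 m j.+1 i t0).
by rewrite big_ord_recr/= lerDr sumr_ge0// => k _; exact: trunc_ge0.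
Qed.

Lemma truncD m i j s t : 0 <= t ->
  trunc m i j (s + t) = \sum_(k < m) trunc m i k s * trunc m k j t.
Proof.
move=> t0; rewrite {1}/trunc; case: ifPn => [/andP[im jm]|].
  by rewrite mexpD//; apply: eq_bigr => k _; rewrite !truncE.
rewrite negb_and -(leqNgt m i) -(leqNgt m j) => mij; rewrite big1// => k _.
case/orP: mij => mij; first by rewrite trunc_out ?mij// mul0r.
by rewrite [X in _ * X]trunc_out ?mulr0// mij orbT.
Qed.

Lemma trunc_cvg i j t : 0 <= t -> trunc m i j t @[m --> \oo] --> minchain i j t.
Proof.
move=> t0; apply: nondecreasing_is_cvgn => [m N mN|]; first exact: trunc_nd.
by exists 1 => _ [m _ <-]; exact: trunc_le1.
Qed.

Lemma trunc_le_minchain m i j t : 0 <= t -> trunc m i j t <= minchain i j t.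
Proof.
move=> t0; apply: (cvgn_ge (N := m) (@trunc_cvg i j t t0)) => N.
exact: trunc_nd.
Qed.

Lemma minchain_ge0 i j t : 0 <= t -> 0 <= minchain i j t.
Proof.
by move=> t0; apply: le_trans (trunc_le_minchain 0 i j t0); exact: trunc_ge0.
Qed.

Lemma sum_trunc_cvg N i t : 0 <= t ->
  \sum_(j < N) trunc m i j t @[m --> \oo] --> \sum_(j < N) minchain i j t.
Proof.
move=> t0; apply: (@cvg_sum_ord _ _ _ _ N (fun j m => trunc m i j t)
  (fun j => minchain i j t)) => j _; exact: trunc_cvg.
Qed.

Lemma sum_minchain_le1 N i t : 0 <= t -> \sum_(j < N) minchain i j t <= 1.
Proof.
move=> t0; apply: (cvgn_le (@sum_trunc_cvg N i t t0)) => m.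
exact: sum_trunc_le1.
Qed.

Lemma minchain0 i j : minchain i j 0 = (j == i)%:R.
Proof.
have H := @trunc_cvg i j 0 (lexx 0); apply/esym/(cvg_unique _ _ H) => //.
apply: cvg_near_cst; near=> m.
rewrite truncE ?mexp0//; near: m; [exact: nbhs_infty_gt|exact: nbhs_infty_gt].
Unshelve. all: by end_near. Qed.

(** Each partial sum is at least the truncation of its own size at time [s + t]; it is also a limit
    of finite sums that are at most truncations at time [s + t], hence at most the minimal chain. *)
Lemma minchainD i j s t : 0 <= s -> 0 <= t ->
  \sum_(k < N) minchain i k s * minchain k j t @[N --> \oo] -->
    minchain i j (s + t).
Proof.
move=> s0 t0; have st0 : 0 <= s + t by exact: addr_ge0.
apply: (@squeeze_cvgr _ _ _ _ (fun N => trunc N i j (s + t))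
  (fun=> minchain i j (s + t))); last 2 first.
- exact: trunc_cvg.
- exact: cvg_cst.
apply: nearW => N; apply/andP; split.
  rewrite truncD//; apply: ler_sum => k _.
  by rewrite ler_pM ?trunc_ge0// trunc_le_minchain.
have H : \sum_(k < N) trunc m i k s * trunc m k j t @[m --> \oo] -->
    \sum_(k < N) minchain i k s * minchain k j t.
  apply: (@cvg_sum_ord _ _ _ _ N (fun k m => trunc m i k s * trunc m k j t)
    (fun k => minchain i k s * minchain k j t)) => k _.
  by apply: cvgM; exact: trunc_cvg.
apply: (cvgn_le H) => m.
apply: le_trans (trunc_le_minchain m i j st0); rewrite truncD//.
apply: (@sum_ord_le_supp R m N (fun k => trunc m i k s * trunc m k j t)) => k.
  by rewrite mulr_ge0// trunc_ge0.
by move=> mk; rewrite trunc_out ?mul0r// mk orbT.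
Qed.

(** Squeeze between two functions with the same value at 0 and the same derivative [Q i j] there: a
    truncated exponential, and this exponential increased by its missing mass. *)
Lemma minchain_rate i j :
  (minchain i j h - (j == i)%:R) / h @[h --> 0^'+] --> Q i j.
Proof.
(* Large enough for row [i] of the truncation to sum to 0, so that the missing mass has derivative 0
   at time 0. *)
have [M HM] := HQ.2 i; pose m := maxn M (maxn i.+1 j.+1).
have im : (i < m)%N by rewrite /m !leq_max leqnn orbT.
have jm : (j < m)%N by rewrite /m !leq_max leqnn !orbT.
pose lo h := mexp Q m i j h.
pose up h := mexp Q m i j h + (1 - \sum_(k < m) mexp Q m i k h).
have sumd (x : nat -> R) : \sum_(l < m) (l == i :> nat)%:R * x l = x i.
  rewrite (bigD1 (Ordinal im))//= eqxx mul1r big1 ?addr0// => l.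
  by rewrite -val_eqE/= => /negbTE ->; rewrite mul0r.
have dlo : is_derive (0 : R) 1 lo (Q i j).
  apply: is_derive_eq (is_derive_mexp Q i 0 jm) _.
  under eq_bigr do rewrite mexp0.
  exact: (sumd (fun l => Q l j)).
have dup : is_derive (0 : R) 1 up (Q i j).
  apply: is_derive_eq (is_derive_funD dlo (is_derive_funB
    (is_derive_const 1 0) (is_derive_mexp_sum Q m i 0))) _.
  under eq_bigr do rewrite mexp0.
  rewrite (sumd (fun l => \sum_(k < m) Q l k)) HM ?subr0 ?addr0//.
  by rewrite /m leq_maxl.
have lo0 : lo 0 = (j == i)%:R by rewrite /lo mexp0.
have up0 : up 0 = (j == i)%:R.
  rewrite /up mexp0 (_ : \sum_(k < m) _ = 1) ?subrr ?addr0//.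
  under eq_bigr do rewrite mexp0 -[_%:R]mulr1.
  exact: (sumd (fun=> 1)).
have := is_derive_at_right dup; have := is_derive_at_right dlo.
rewrite lo0 up0 => Hlo Hup; apply: squeeze_cvgr Hlo Hup.
near=> h; have h0 : 0 < h by near: h; exact: nbhs_right_gt.
rewrite add0r !ler_pM2r ?invr_gt0// !lerD2r; apply/andP; split.
  by rewrite /lo -truncE//; apply: trunc_le_minchain; exact: ltW.
(* The chain has mass at most 1 and dominates the truncation in the other states, which leaves at
   most [up h] for state [j]. *)
have := sum_minchain_le1 m i (ltW h0); rewrite (bigD1 (Ordinal jm))//= => H.
rewrite /up [X in 1 - X](bigD1 (Ordinal jm))//= opprD addrCA addNKr.
rewrite lerBrDr; apply: le_trans H; rewrite lerD2l; apply: ler_sum => k _.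
by rewrite -truncE// trunc_le_minchain// ltW.
Unshelve. all: by end_near. Qed.

(** Comparison on each truncation, then passage to the limit. The inequality is asked only for
    [j.+1 < m] because a birth-death truncation must contain the deaths from [j.+1] for its column
    [j] to have the form of the forward equation. *)
Lemma minchain_le_super i (w dw : nat -> R -> R) :
  (forall j t, 0 < t -> is_derive t 1 (w j) (dw j t)) ->
  (forall j m t, (j.+1 < m)%N -> 0 < t -> \sum_(k < m) w k t * Q k j <= dw j t) ->
  (forall j, w j s @[s --> 0^'+] --> w j 0) ->
  (forall j, (j == i)%:R <= w j 0) ->
  (forall j t, 0 <= t -> 0 <= w j t) ->
  forall j t, 0 <= t -> minchain i j t <= w j t.
Proof.
move=> wdw wQ w0c wi w0 j t t0; apply: (cvgn_le (@trunc_cvg i j t t0)) => m.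
rewrite /trunc; case: ifP => [/andP[im jm]|_]; last exact: w0.
apply: (mexp_le_super HQ (dw := dw)) => // k s km s0.
(* One more state brings every [k < m] within the hypothesis; the term it adds is nonnegative. *)
apply: le_trans (wQ k m.+1 s _ s0) => //.
rewrite big_ord_recr/= lerDl mulr_ge0//; first by rewrite w0// ltW.
by apply: HQ.1; rewrite gtn_eqF.
Qed.
End MinimalChain.

(** * Series of nonnegative reals through their partial sums *)

Section Series.
Context {R : realType}.
Implicit Types (r k m N : nat) (f g : nat -> R) (c : R).

Lemma sum_EFin_ord r N (f : nat -> R) :
  (\sum_(r <= k < N + r) (f k)%:E = (\sum_(k < N) f (r + k)%N)%:E)%E.
Proof.
rewrite -[X in index_iota X _](add0n r) big_addn addnK big_mkord sumEFin.
by congr EFin; apply: eq_bigr => k _; rewrite addnC.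
Qed.

(** Links the extended series over the states from [r] on, used in the definitions, to real partial
    sums over states shifted to start at 0. *)
Lemma nnseries_cvgP r f c : (forall k, (r <= k)%N -> 0 <= f k) ->
  (\sum_(r <= k <oo) (f k)%:E = c%:E)%E <->
  \sum_(k < N) f (r + k)%N @[N --> \oo] --> c.
Proof.
move=> f0.
have H : (\sum_(r <= k < N) (f k)%:E)%E @[N --> \oo] -->
    (\sum_(r <= k <oo) (f k)%:E)%E.
  by apply: is_cvg_ereal_nneg_natsum => k rk; rewrite lee_fin f0.
have E : [sequence (\sum_(r <= k < N + r) (f k)%:E)%E]_N =
    EFin \o (fun N => \sum_(k < N) f (r + k)%N).
  by apply/funext => N; exact: sum_EFin_ord.
split=> [fc|fc].
  move: H; rewrite fc -(cvg_shiftn r) E => H.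
  exact: fine_cvg H.
apply/cvg_lim => //; rewrite -(cvg_shiftn r) E.
by apply: cvg_EFin => //; exact: nearW.
Qed.

Lemma nnseries_le r f c : (forall k, (r <= k)%N -> 0 <= f k) ->
  (forall N, \sum_(k < N) f (r + k)%N <= c) ->
  (\sum_(r <= k <oo) (f k)%:E <= c%:E)%E.
Proof.
move=> f0 fc; apply: lime_le.
  by apply: is_cvg_ereal_nneg_natsum => k rk; rewrite lee_fin f0.
near=> N; have rN : (r <= N)%N by near: N; exact: nbhs_infty_ge.
by rewrite -(subnK rN) sum_EFin_ord lee_fin.
Unshelve. all: by end_near. Qed.

Lemma nnseries_partial_le r f c N : (forall k, (r <= k)%N -> 0 <= f k) ->
  (\sum_(r <= k <oo) (f k)%:E <= c%:E)%E -> \sum_(k < N) f (r + k)%N <= c.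
Proof.
move=> f0 fc; rewrite -lee_fin -sum_EFin_ord; apply: le_trans fc.
by apply: nneseries_lim_ge => k rk _; rewrite lee_fin f0.
Qed.

Lemma tailE r f c m : (forall k, (r <= k)%N -> 0 <= f k) ->
  (\sum_(r <= k <oo) (f k)%:E = c%:E)%E ->
  tail f (r + m)%N = c - \sum_(k < m) f (r + k)%N.
Proof.
move=> f0 fc; rewrite /tail.
have : (\sum_(r <= k <oo) (f k)%:E)%E =
    ((\sum_(k < m) f (r + k)%N)%:E + \sum_(r + m <= k <oo) (f k)%:E)%E.
  rewrite (@nneseries_split _ (fun k => (f k)%:E) r m).
    by rewrite [(r + m)%N in X in (X + _)%E]addnC sum_EFin_ord.
  by move=> k rk; rewrite lee_fin f0.
rewrite fc; case: (\sum_(r + m <= k <oo) (f k)%:E)%E => //= x [cE].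
by rewrite cE; ring.
Qed.

Lemma nd_sum_ord_le_lim f c N : (forall k, 0 <= f k) ->
  \sum_(k < N) f k @[N --> \oo] --> c -> \sum_(k < N) f k <= c.
Proof.
move=> f0 fc; apply: (cvgn_ge (N := N) fc) => m Nm; exact: sum_ord_le.
Qed.

(** The partial sums of the nonnegative terms [g k - f k] are at most [c] minus those of [f], which
    tends to 0. Domination thus becomes equality once the smaller family has full mass. *)
Lemma dominated_mass_eq f g c m : (forall k, f k <= g k) ->
  \sum_(k < N) f k @[N --> \oo] --> c -> (forall N, \sum_(k < N) g k <= c) ->
  f m = g m.
Proof.
move=> fg fc gc; apply/eqP; rewrite eq_le fg/=.
have H : c - \sum_(k < N) f k @[N --> \oo] --> c - c.
  by apply: cvgB => //; exact: cvg_cst.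
rewrite -subr_le0 -[leRHS](subrr c); apply: (cvgn_ge (N := m.+1) H) => N mN.
apply: (@le_trans _ _ (\sum_(k < N) (g k - f k))).
  rewrite (bigD1 (Ordinal mN))//= lerDl sumr_ge0// => k _.
  by rewrite subr_ge0.
by rewrite sumrB lerD2r.
Qed.
End Series.

(** * Identification of a chain of given rates with the minimal one *)

Section MinimalTransitionFunction.
Context {R : realType} (r : nat) (a Q : nat -> nat -> R) (HQ : qmatrix Q).
Context (aQ : forall i j, generator r a (r + i) (r + j) = Q i j).

Lemma transition_function_minchain :
  transition_function r a (fun i n t => minchain Q (i - r) (n - r) t).
Proof.
split.
- by move=> i n t ri rn t0; exact: minchain_ge0.
- move=> i t ri t0; apply: nnseries_le => [k rk|N]; first exact: minchain_ge0.
  by under eq_bigr do rewrite addKn; exact: sum_minchain_le1.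
- move=> i n ri rn; rewrite minchain0//.
  by rewrite -[in RHS](subnK ri) -[in RHS](subnK rn) eqn_add2r.
- move=> i n s t ri rn s0 t0; apply/esym/nnseries_cvgP => [k rk|].
    by rewrite mulr_ge0// minchain_ge0.
  under eq_fun do under eq_bigr do rewrite addKn.
  exact: minchainD.
- move=> i n ri rn; rewrite -{3}(subnKC ri) -{3}(subnKC rn) aQ.
  rewrite (_ : (n == i) = (n - r == i - r)%N); first exact: minchain_rate.
  by rewrite -[in LHS](subnK ri) -[in LHS](subnK rn) eqn_add2r.
Qed.

Lemma markov_chain_le_minchain p i j t : markov_chain r a p -> 0 <= t ->
  p (r + i)%N (r + j)%N t <= minchain Q i j t.
Proof.
move=> [_ pmin] t0.
have := pmin _ transition_function_minchain (r + i)%N (r + j)%N t.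
by rewrite !leq_addr !addKn; exact.
Qed.

(** Minimality bounds [p] by [minchain], and full mass of [p] leaves no room for a strict
    inequality. *)
Lemma markov_chain_minchain p i j t : markov_chain r a p ->
  nonexplosive_from r p (r + i) -> 0 <= t ->
  p (r + i)%N (r + j)%N t = minchain Q i j t.
Proof.
move=> mp p1 t0.
apply: (@dominated_mass_eq R (fun j => p (r + i)%N (r + j)%N t)
  (fun j => minchain Q i j t) 1 j).
- by move=> k; exact: markov_chain_le_minchain.
- have p0 k : (r <= k)%N -> 0 <= p (r + i)%N k t.
    by move=> rk; apply: (tf_ge0 mp.1) => //; exact: leq_addr.
  by apply/(nnseries_cvgP 1 p0); exact: p1.
- by move=> N; exact: sum_minchain_le1.
Qed.
End MinimalTransitionFunction.

(** * The generator of a birth-death process with catastrophes *)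

Section CatastropheGenerator.
Context {R : realType}.
Implicit Types (al be x y : nat -> R) (xi : R) (i j k m : nat) (s t : R).

(* States are shifted so that [r] becomes 0, and [be 0 = 0] is assumed where
   needed.  Catastrophes are also allowed from 0 to itself, where they cancel
   out. *)
Definition cat_gen al be xi i j : R :=
  al i *+ (j == i.+1) + be i *+ (i == j.+1) + xi *+ (j == 0%N) -
  (al i + be i + xi) *+ (i == j).

(* [M] is the mass of [x] subject to catastrophes: 1 for the whole chain, the
   truncated sum of [x] for its restriction to finitely many states. *)
Definition forward al be xi (x : nat -> R) (M : R) j : R :=
  (if j is j'.+1 then al j' * x j' else 0) + be j.+1 * x j.+1 +
  (xi * M) *+ (j == 0%N) - (al j + be j + xi) * x j.

Lemma sum_delta m c (f : nat -> R) : (c < m)%N ->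
  \sum_(k < m) f k *+ (k == c :> nat) = f c.
Proof.
move=> cm; rewrite (bigD1 (Ordinal cm))//= eqxx big1 ?addr0// => k.
by rewrite -val_eqE/= => /negbTE ->.
Qed.

Lemma cat_gen_row al be xi i m : be 0%N = 0 -> (i.+1 < m)%N ->
  \sum_(j < m) cat_gen al be xi i j = 0.
Proof.
move=> be0 im; rewrite /cat_gen sumrB !big_split/=.
rewrite (@sum_delta m i.+1 (fun=> al i))// (@sum_delta m 0 (fun=> xi)); last first.
  exact: leq_trans im.
under [X in _ - X]eq_bigr do rewrite eq_sym.
rewrite (@sum_delta m i (fun=> al i + be i + xi)); last exact: ltnW.
suff -> : \sum_(j < m) be i *+ (i == j.+1) = be i by rewrite subrr.
(* No [j] satisfies [0 = j.+1], so row 0 has no death term and [be 0 = 0] balances the diagonal. *)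
case: i im => [|i] im.
  by rewrite be0 big1// => k _; rewrite mul0rn.
under eq_bigr do rewrite eqSS eq_sym.
by rewrite (@sum_delta m i (fun=> be i.+1))// (leq_trans _ im)//; lia.
Qed.

(** The condition [j.+1 < m] keeps the deaths from [j.+1] inside the truncation; catastrophes
    collect the whole truncated mass. *)
Lemma cat_gen_col al be xi x j m : (j.+1 < m)%N ->
  \sum_(k < m) x k * cat_gen al be xi k j =
  forward al be xi x (\sum_(k < m) x k) j.
Proof.
move=> jm; rewrite /cat_gen /forward.
under eq_bigr do rewrite mulrBr !mulrDr !mulrnAr.
rewrite sumrB !big_split/=; congr (_ + _ + _ - _).
- case: j jm => [|j] jm; first by rewrite big1.
  under eq_bigr do rewrite eqSS eq_sym.
  rewrite (@sum_delta m j (fun k => x k * al k)) 1?mulrC//.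
  by rewrite (leq_trans _ jm)//; lia.
- by rewrite (@sum_delta m j.+1 (fun k => x k * be k)) 1?mulrC.
- by rewrite sumrMnl -mulr_suml mulrC.
- by rewrite (@sum_delta m j (fun k => x k * (al k + be k + xi))) 1?mulrC// ltnW.
Qed.

Lemma cat_gen_qmatrix al be xi : (forall i, 0 <= al i) ->
  (forall i, 0 <= be i) -> be 0%N = 0 -> 0 <= xi -> qmatrix (cat_gen al be xi).
Proof.
move=> al0 beg be0 xi0; split=> [k j kj|i].
  rewrite /cat_gen (negbTE kj) mulr0n subr0.
  by rewrite !addr_ge0// mulrn_wge0.
by exists i.+2 => m im; exact: cat_gen_row.
Qed.

Lemma forwardB al be xi x y (M N : R) j :
  forward al be xi x M j - forward al be xi y N j =
  forward al be xi (fun k => x k - y k) (M - N) j.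
Proof. by rewrite /forward; case: j => [|j]; rewrite ?mulr1n ?mulr0n; ring. Qed.

Lemma forward_norm al be xi x M (K : nat -> R) j : (forall i, 0 <= al i) ->
  (forall i, 0 <= be i) -> 0 <= xi ->
  (forall k, (k <= j.+1)%N -> `|x k| <= K k) ->
  `|forward al be xi x M j| <=
  (if j is j'.+1 then al j' * K j' else 0) + be j.+1 * K j.+1 +
  (al j + be j + xi) * K j + xi * `|M|.
Proof.
move=> al0 beg xi0 xK; rewrite /forward.
have B b k : 0 <= b -> (k <= j.+1)%N -> `|b * x k| <= b * K k.
  by move=> b0 kj; rewrite normrM ger0_norm// ler_wpM2l// xK.
rewrite [leRHS]addrAC (le_trans (ler_normB _ _))// lerD//; last first.
  by rewrite B// !addr_ge0.
rewrite (le_trans (ler_normD _ _))// lerD//; last first.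
  case: eqP => _; rewrite ?mulr1n ?mulr0n ?normrM ?normr0 ?(ger0_norm xi0)//.
  by rewrite mulr_ge0.
rewrite (le_trans (ler_normD _ _))// lerD//; last by rewrite B.
case: j {xK} B => [|j] B; first by rewrite normr0.
by rewrite B// ltnW.
Qed.

Lemma generator_cat_gen r (alpha beta : nat -> R) xi :
  (forall n, (r <= n)%N -> 0 < alpha n) ->
  (forall n, (r < n)%N -> 0 <= beta n) -> 0 <= xi -> forall i j,
  generator r (catastrophe_rates r alpha beta xi) (r + i) (r + j) =
  cat_gen (fun i => alpha (r + i)%N)
    (fun i => if i is 0%N then 0 else beta (r + i)%N) xi i j.
Proof.
move=> alpha0 beta0 xi0 i j.
set Q := cat_gen _ _ _.
have offdiag k : k != i ->
    catastrophe_rates r alpha beta xi (r + i)%N (r + k)%N = Q i k.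
  move=> ki; rewrite /catastrophe_rates /Q /cat_gen.
  rewrite [i == k]eq_sym (negbTE ki) mulr0n subr0 -!addnS !eqn_add2l.
  rewrite (_ : (r < r + i)%N = (0 < i)%N); last by lia.
  rewrite (_ : (r + k == r)%N = (k == 0)%N); last by lia.
  (* At state 0 the catastrophe of [cat_gen] onto itself, absent from the rates, affects only the
     diagonal. *)
  case: i ki => [|i] ki /=; last by do 3 case: eqP.
  by rewrite (negbTE ki) mul0rn mulr0n; case: eqP.
have HQ : qmatrix Q.
  apply: cat_gen_qmatrix => // [k|[|k]//]; first by rewrite ltW// alpha0// leq_addr.
  by apply: beta0; lia.
rewrite /generator eqn_add2l; case: eqP => [->|/eqP]; last exact: offdiag.
rewrite /exit_rate eseries_mkcond.
pose f k := if k != (r + i)%N then catastrophe_rates r alpha beta xi (r + i) k else 0.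
rewrite (_ : (fun n => _) = (fun n => \sum_(r <= k < n) (f k)%:E)%E); last first.
  by apply/funext => n; apply: eq_bigr => k _; rewrite /f; case: ifP.
have fE k : f (r + k)%N = if k == i then 0 else Q i k.
  by rewrite /f eqn_add2l; case: eqP => //= /eqP; exact: offdiag.
(* As the row of [cat_gen] sums to 0, the exit rate is the opposite of its diagonal entry. *)
suff -> : (\sum_(r <= k <oo) (f k)%:E)%E = (- Q i i)%:E by rewrite /= opprK.
apply/nnseries_cvgP => [k rk|].
  rewrite -(subnKC rk) fE; case: eqP => // /eqP ki.
  by apply: HQ.1; rewrite eq_sym.
apply: cvg_near_cst; near=> N.
have iN : (i.+1 < N)%N by near: N; exact: nbhs_infty_gt.
under eq_bigr do rewrite fE.
have := @cat_gen_row (fun i => alpha (r + i)%N)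
  (fun i => if i is 0%N then 0 else beta (r + i)%N) xi i N erefl iN.
rewrite (bigD1 (Ordinal (ltnW iN)))//= => /eqP; rewrite addrC addr_eq0 => /eqP <-.
rewrite (bigD1 (Ordinal (ltnW iN)))//= eqxx add0r.
by apply: eq_bigr => k; rewrite -val_eqE/= => /negbTE ->.
Unshelve. all: by end_near. Qed.
End CatastropheGenerator.

(** * Forward equations of the minimal chain *)

Section ForwardEquation.
Context {R : realType}.
Implicit Types (i j k m N : nat) (s t : R).

(** The slopes at [t] differ from [a] by at most [C * |s - t|], so they extend continuously by
    [a]. *)
Lemma is_derive_quadratic (f : R -> R) (a C t d : R) : 0 < d ->
  (forall s, `|s - t| < d -> `|f s - f t - a * (s - t)| <= C * `|s - t| ^+ 2) ->
  is_derive t 1 f a.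
Proof.
move=> d0 H; apply/is_derive1_caratheodory.
pose g s := if s == t then a else (f s - f t) / (s - t).
exists g; split; last by rewrite /g eqxx.
- move=> s; rewrite /g; case: eqP => [->|/eqP st]; first by rewrite !subrr mulr0.
  by rewrite divfK// subr_eq0.
apply/cvgrPdist_le => e e0.
have D eps : 0 < eps -> \forall s \near t, `|s - t| < eps.
  by move=> eps0; apply/nbhs_ballP; exists eps => //= s; rewrite /ball/= distrC.
near=> s; rewrite {1}/g eqxx distrC /g.
case: eqP => [_|/eqP st]; first by rewrite subrr normr0 ltW.
have st0 : 0 < `|s - t| by rewrite normr_gt0 subr_eq0.
have sd : `|s - t| < d.
  by near: s; exact: D.
have se : `|s - t| < e / (`|C| + 1).
  near: s; apply: D.
  by rewrite divr_gt0// ltr_wpDl.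
rewrite -(ler_pM2r st0) -normrM mulrBl divfK ?subr_eq0//.
apply: le_trans (H s sd) _; rewrite expr2 mulrA ler_pM2r//.
rewrite (le_trans (y := (`|C| + 1) * `|s - t|))//.
  by rewrite ler_wpM2r// ler_wpDr// ler_norm.
by rewrite mulrC -ler_pdivlMr ?ltr_wpDl// ltW.
Unshelve. all: by end_near. Qed.

(* The oscillation bound makes the convergence of the difference quotients
   uniform in [m], up to the vanishing error [e m]. *)
Lemma is_derive_lim (u du : nat -> R -> R) (e : nat -> R) (f : R -> R)
    (g C t : R) M : 0 <= C -> 0 < t ->
  (forall m s, (M <= m)%N -> 0 < s -> is_derive s 1 (u m) (du m s)) ->
  (forall m, (M <= m)%N -> u m s @[s --> 0^'+] --> u m 0) ->
  (forall s, 0 < s -> u m s @[m --> \oo] --> f s) ->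
  du m t @[m --> \oo] --> g ->
  e @ \oo --> 0 ->
  (forall m s, (M <= m)%N -> 0 < s <= t + t ->
     `|du m s - du m t| <= C * `|s - t| + e m) ->
  is_derive t 1 f g.
Proof.
move=> C0 t0 udu u0 uf dug e0 osc.
(* The radius [t] keeps [s] between 0 and [t + t], where the oscillation bound holds. *)
apply: (@is_derive_quadratic f g C t t t0) => s; rewrite ltr_norml => /andP[ts st].
have s0 : 0 < s by lra.
have H1 : `|u m s - u m t - du m t * (s - t)| @[m --> \oo] -->
    `|f s - f t - g * (s - t)|.
  apply: cvg_norm; apply: cvgB; first by apply: cvgB; exact: uf.
  by apply: cvgM => //; exact: cvg_cst.
have H2 : (C * `|s - t| + e m) * `|s - t| @[m --> \oo] -->
    (C * `|s - t| + 0) * `|s - t|.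
  apply: cvgM; last exact: cvg_cst.
  by apply: cvgD => //; exact: cvg_cst.
rewrite expr2 mulrA -[C * _]addr0; apply: (ler_cvg_to H1 H2).
exists M => // m /= Mm.
have [c [c0 ct cE]] : exists c, [/\ 0 < c <= t + t, `|c - t| <= `|s - t| &
    u m s - u m t = du m c * (s - t)].
  have D (v : R) : 0 < v -> is_derive v 1 (u m) (du m v) by move=> v0; exact: udu.
  case: (ltgtP s t) => [lst|lst|->].
  - have [c /andP[sc ct] E] := MVT0 (ltW s0) lst D (u0 m Mm).
    exists c; split; first by apply/andP; split; lra.
      by rewrite !ler0_norm; lra.
    by rewrite -opprB E -mulrN opprB.
  - have [c /andP[tc cs] E] := MVT0 (ltW t0) lst D (u0 m Mm).
    exists c; split => //; first by apply/andP; split; lra.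
    by rewrite !ger0_norm; lra.
  - by exists t; split; rewrite ?subrr ?mulr0//; apply/andP; split; lra.
rewrite cE -mulrBl normrM ler_wpM2r//.
apply: le_trans (osc m c Mm c0) _; rewrite lerD2r ler_wpM2l//.
Qed.

(** The difference quotients at 0 have a finite limit by [minchain_rate]; multiplied by [h] they
    vanish. *)
Lemma minchain_cvg0 (Q : nat -> nat -> R) i j : qmatrix Q ->
  minchain Q i j s @[s --> 0^'+] --> minchain Q i j 0.
Proof.
move=> HQ; rewrite minchain0//.
have H : (j == i)%:R + h * ((minchain Q i j h - (j == i)%:R) / h) @[h --> 0^'+]
    --> (j == i)%:R + 0 * Q i j.
  apply: cvgD; first exact: cvg_cst.
  apply: cvgM; last exact: minchain_rate.
  by apply: cvg_at_right_filter; exact: cvg_id.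
rewrite mul0r addr0 in H; apply: cvg_trans H; apply: near_eq_cvg; near=> h.
have h0 : h != 0 by rewrite gt_eqF//; near: h; exact: nbhs_right_gt.
by rewrite mulrC divfK// addrC subrK.
Unshelve. all: by end_near. Qed.

(** Some finite set of states carries mass above [1 - e] in the limit chain, hence also in all large
    truncations. *)
Lemma mexp_sum_cvg (Q : nat -> nat -> R) i t : qmatrix Q -> 0 <= t ->
  \sum_(k < N) minchain Q i k t @[N --> \oo] --> (1 : R) ->
  \sum_(k < m) mexp Q m i k t @[m --> \oo] --> (1 : R).
Proof.
move=> HQ t0 H; apply/cvgrPdist_lt => e e0.
have e1 : 1 - e < 1 by lra.
have [N _ HN] := cvgr_gt _ H _ e1; have {HN} /= P := HN N (leqnn N).
have SN := @sum_trunc_cvg _ _ HQ N i t t0.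
have [M _ HM] := (cvgr_gt _ SN) _ P.
near=> m.
have im : (i < m)%N by near: m; exact: nbhs_infty_gt.
have Nm : (N <= m)%N by near: m; exact: nbhs_infty_ge.
have Mm : (M <= m)%N by near: m; exact: nbhs_infty_ge.
have S1 := mexp_sum_le1 HQ im t0.
have S2 : \sum_(k < N) trunc Q m i k t <= \sum_(k < m) mexp Q m i k t.
  apply: le_trans (sum_ord_le (f := fun k => trunc Q m i k t) Nm _) _.
    by move=> k _; exact: trunc_ge0.
  by apply: ler_sum => k _; rewrite truncE.
have /= S3 := HM m Mm.
by rewrite ger0_norm; lra.
Unshelve. all: by end_near. Qed.

Context (al be : nat -> R) (xi : R) (al0 : forall i, 0 <= al i)
  (be_ge0 : forall i, 0 <= be i) (be0 : be 0%N = 0) (xi0 : 0 <= xi).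
Let Q := cat_gen al be xi.
Let HQ : qmatrix Q := cat_gen_qmatrix al0 be_ge0 be0 xi0.

(** Bound on the derivative of coordinate [j], uniform in the truncation: [forward_norm] with
    entries and mass at most 1. *)
Let K j : R := (if j is j'.+1 then al j' else 0) + be j.+1 + (al j + be j + xi) + xi.

Let K0 j : 0 <= K j.
Proof.
by rewrite /K; case: j => [|j]; rewrite !addr_ge0//.
Qed.

Lemma cat_gen_mexp_lip m i j s t : (i < m)%N -> (j.+1 < m)%N ->
  0 <= s -> 0 <= t ->
  `|mexp Q m i j s - mexp Q m i j t| <= K j * `|s - t|.
Proof.
move=> im jm.
wlog st : s t / s <= t.
  move=> H s0 t0; have [st|/ltW ts] := leP s t; first exact: H.
  by rewrite distrC [`|s - t|]distrC; exact: H.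
rewrite le_eqVlt in st; case/predU1P: st => [->|st] s0 t0.
  by rewrite !subrr normr0 mulr0.
have jm' := ltnW jm.
have D (v : R) : 0 < v -> is_derive v 1 (mexp Q m i j)
    (forward al be xi (fun k => mexp Q m i k v) (\sum_(k < m) mexp Q m i k v) j).
  by move=> v0; rewrite -cat_gen_col//; exact: is_derive_mexp.
have [c /andP[sc ct] E] := MVT0 s0 st D (@mexp_cvg0 _ Q m i j jm').
have c0 : 0 <= c by apply: ltW; apply: le_lt_trans sc.
rewrite distrC [`|s - t|]distrC E normrM ler_wpM2r//.
have M1 k : (k <= j.+1)%N -> `|mexp Q m i k c| <= 1.
  move=> kj; have km : (k < m)%N by apply: leq_trans jm.
  rewrite ger0_norm ?mexp_ge0//.
  by rewrite -truncE// trunc_le1.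
apply: le_trans (forward_norm _ (K := fun=> 1) al0 be_ge0 xi0 M1) _.
rewrite !mulr1 /K; apply: lerD.
  by case: (j) => [|j']; rewrite ?mulr1.
rewrite -[leRHS]mulr1 ler_wpM2l// ger0_norm ?mexp_sum_le1//.
by apply: sumr_ge0 => k _; exact: mexp_ge0.
Qed.

(** The truncated forward equations pass to the limit. Their catastrophe term contains the truncated
    mass, which tends to 1 because the chain has full mass. *)
Lemma forward_equation i j t : 0 < t ->
  (forall s, 0 <= s ->
    \sum_(k < N) minchain Q i k s @[N --> \oo] --> (1 : R)) ->
  is_derive t 1 (minchain Q i j)
    (forward al be xi (fun k => minchain Q i k t) 1 j).
Proof.
move=> t0 honest.
pose S m s := \sum_(k < m) mexp Q m i k s.
(* Lipschitz constant of all terms of [forward] except the mass term, from the constants [K] of [j]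
   and its neighbours. *)
pose C := (if j is j'.+1 then al j' * K j' else 0) + be j.+1 * K j.+1 +
  (al j + be j + xi) * K j.
have C0 : 0 <= C.
  have P b k : 0 <= b -> 0 <= b * K k by move=> b0; exact: mulr_ge0.
  rewrite /C !addr_ge0 ?P// ?addr_ge0//.
  by case: (j) => [|j'] //; exact: P.
have t2 : 0 <= t + t by lra.
(* Room for [i] and for the Lipschitz bound at [j.+1], which requires [j.+2 < m]. *)
pose M := maxn i.+1 j.+3.
have iM m : (M <= m)%N -> (i < m)%N by rewrite /M; lia.
have jM m : (M <= m)%N -> (j.+2 < m)%N by rewrite /M; lia.
have SC s : 0 <= s -> S m s @[m --> \oo] --> (1 : R).
  by move=> s0; apply: mexp_sum_cvg => //; exact: honest.
have MC k s : 0 <= s -> mexp Q m i k s @[m --> \oo] --> minchain Q i k s.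
  move=> s0; apply: cvg_trans (trunc_cvg HQ (i := i) (j := k) s0).
  apply: near_eq_cvg; near=> m; rewrite truncE//; near: m; exact: nbhs_infty_gt.
(* Up to time [t + t] the truncated mass lies between [S m (t + t)] and 1, whence the error term. *)
apply: (@is_derive_lim (fun m => mexp Q m i j)
  (fun m s => forward al be xi (fun k => mexp Q m i k s) (S m s) j)
  (fun m => xi * (1 - S m (t + t))) _ _ C t M) => //.
- move=> m s Mm s0; have jm := jM m Mm.
  by rewrite -cat_gen_col; [apply: is_derive_mexp; lia | lia].
- by move=> m Mm; apply: mexp_cvg0; have := jM m Mm; lia.
- by move=> s s0; apply: MC; exact: ltW.
- rewrite /forward; apply: cvgB; last first.
    by apply: cvgM; [exact: cvg_cst | apply: MC; exact: ltW].
  apply: cvgD; last first.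
    case: eqP => _; last exact: cvg_cst.
    by apply: cvgM; [exact: cvg_cst | apply: SC; exact: ltW].
  apply: cvgD; last first.
    by apply: cvgM; [exact: cvg_cst | apply: MC; exact: ltW].
  case: (j) => [|j']; first exact: cvg_cst.
  by apply: cvgM; [exact: cvg_cst | apply: MC; exact: ltW].
- rewrite -[X in _ --> X](mulr0 xi) -(subrr 1).
  apply: cvgM; first exact: cvg_cst.
  by apply: cvgB; [exact: cvg_cst | exact: SC].
- move=> m s Mm /andP[s0 st]; rewrite forwardB.
  have im := iM m Mm; have jm := jM m Mm.
  have L k : (k <= j.+1)%N ->
      `|mexp Q m i k s - mexp Q m i k t| <= K k * `|s - t|.
    by move=> kj; apply: cat_gen_mexp_lip; [ | lia | lra | lra].
  apply: le_trans (forward_norm _ (K := fun k => K k * `|s - t|) al0 be_ge0 xi0 L) _.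
  apply: lerD.
    by rewrite le_eqVlt /C; apply/orP; left; apply/eqP; case: (j) => [|j']; ring.
  rewrite ler_wpM2l//.
  have H (v : R) : 0 <= v -> v <= t + t -> S m (t + t) <= S m v <= 1.
    move=> v0 vt; rewrite mexp_sum_nincr//=; exact: mexp_sum_le1.
  have /andP[h1 h2] : S m (t + t) <= S m s <= 1 by apply: H => //; exact: ltW.
  have /andP[h3 h4] : S m (t + t) <= S m t <= 1 by apply: H; lra.
  by rewrite ler_norml; apply/andP; split; lra.
Unshelve. all: by end_near. Qed.
End ForwardEquation.

(** * The steady state and the decomposition of the chain *)

Section Decomposition.
Context {R : realType}.
Implicit Types (i j k m n N : nat) (s t : R).

(** By the mean value theorem on [[T, T + 1]] the derivative at some point equals an increment of
    [f], which is small for large [T]. *)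
Lemma derive_lim_eq0 (f df : R -> R) (l L : R) :
  (forall t, 0 < t -> is_derive t 1 f (df t)) ->
  f t @[t --> +oo] --> l -> df t @[t --> +oo] --> L -> L = 0.
Proof.
move=> fdf fl dfL; apply/eqP; rewrite -normr_le0; apply/ler_addgt0Pr => e e0.
have e3 : 0 < e / 3 by rewrite divr_gt0.
have [A [_ HA]] : \forall t \near +oo, `|l - f t| < e / 3 by exact: cvgr_dist_lt.
have [B [_ HB]] : \forall t \near +oo, `|L - df t| < e / 3 by exact: cvgr_dist_lt.
pose T := `|A| + `|B| + 1.
have TA : A < T by rewrite /T; have := ler_norm A; have := normr_ge0 B; lra.
have TB : B < T by rewrite /T; have := ler_norm B; have := normr_ge0 A; lra.
have T0 : 0 < T by rewrite /T; have := normr_ge0 B; have := normr_ge0 A; lra.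
have TT : T < T + 1 by rewrite ltrDl.
have cf : {within `[T, T + 1], continuous f}.
  apply: derivable_within_continuous => x /[!in_itv]/= /andP[Tx _].
  by have [] := fdf x (lt_le_trans T0 Tx).
have D x : x \in `]T, (T + 1)[%R -> is_derive x 1 f (df x).
  rewrite in_itv/= => /andP[Tx _]; apply: fdf; exact: lt_trans Tx.
have [c] := MVT TT D cf; rewrite in_itv/= => /andP[Tc _] E.
have {}E : f (T + 1) - f T = df c by rewrite E; ring.
have /ltr_normlP[h1 h2] := HA T TA.
have /ltr_normlP[h3 h4] := HA (T + 1) (lt_trans TA TT).
have /ltr_normlP[h5 h6] := HB c (lt_trans TB Tc).
by rewrite add0r; apply/ler_normlP; split; lra.
Qed.

Lemma cvg_forward {T : Type} (F : set_system T) {FF : Filter F} (al be : nat -> R)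
    xi (x : nat -> T -> R) (y : nat -> R) M j :
  (forall k, x k t @[t --> F] --> y k) ->
  forward al be xi (x ^~ t) M j @[t --> F] --> forward al be xi y M j.
Proof.
move=> xy; have H b k : b * x k t @[t --> F] --> b * y k.
  by apply: cvgM; [exact: cvg_cst | exact: xy].
rewrite /forward; apply: cvgB => //; apply: cvgD; last exact: cvg_cst.
by apply: cvgD => //; case: j => [|j] //; exact: cvg_cst.
Qed.

Lemma forward_le_mass (al be : nat -> R) xi x (M N : R) j : 0 <= xi -> M <= N ->
  forward al be xi x M j <= forward al be xi x N j.
Proof.
move=> xi0 MN; rewrite lerD2r lerD2l; case: eqP => _ //.
by rewrite !mulr1n ler_wpM2l.
Qed.

(** Telescoping: the net flux through the cut between [n - 1] and [n] remains. *)
Lemma sum_forward (al be x : nat -> R) (M : R) n : be 0%N = 0 ->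
  \sum_(k < n) forward al be 0 x M k =
  if n is n'.+1 then be n * x n - al n' * x n' else 0.
Proof.
move=> be0; elim: n => [|n IHn]; first by rewrite big_ord0.
rewrite big_ord_recr/= IHn /forward mul0r mul0rn.
by case: n {IHn} => [|n]; rewrite ?be0; ring.
Qed.

Context (al be q : nat -> R) (xi : R) (al0 : forall n, 0 < al n)
  (be_ge0 : forall n, 0 <= be n) (be0 : be 0%N = 0) (xi0 : 0 < xi)
  (q_ge0 : forall n, 0 <= q n)
  (q1 : \sum_(k < N) q k @[N --> \oo] --> (1 : R)).

Let al_ge0 n : 0 <= al n. Proof. exact: ltW. Qed.
Let xi_ge0 : 0 <= xi. Proof. exact: ltW. Qed.
Let Qt n := 1 - \sum_(k < n) q k.
Let F := minchain (cat_gen al be xi).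
Let Fh := minchain (cat_gen al be 0).

Context (F1 : forall j t, 0 <= t -> \sum_(k < N) F j k t @[N --> \oo] --> (1 : R))
  (Fh1 : forall j t, 0 <= t -> \sum_(k < N) Fh j k t @[N --> \oo] --> (1 : R))
  (Fq : forall n, F 0%N n t @[t --> +oo] --> q n).

Let HQ := cat_gen_qmatrix al_ge0 be_ge0 be0 xi_ge0.
Let HQh := cat_gen_qmatrix al_ge0 be_ge0 be0 (lexx 0).

Let QtS n : Qt n.+1 = Qt n - q n.
Proof. by rewrite /Qt big_ord_recr/= opprD addrA. Qed.

Let Qt0 : Qt 0%N = 1. Proof. by rewrite /Qt big_ord0 subr0. Qed.

(** [F 0 n t] converges and so does its derivative, by the forward equation; the limit of the
    derivative must be 0. *)
Lemma steady_forward n : forward al be xi q 1 n = 0.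
Proof.
have D t : 0 < t -> is_derive t 1 (F 0%N n) (forward al be xi (F 0%N ^~ t) 1 n).
  by move=> t0; apply: forward_equation => // s s0; exact: F1.
apply: (derive_lim_eq0 D (@Fq n)).
by apply: (@cvg_forward R (+oo)%R _ al be xi (F 0%N) q 1 n) => k; exact: Fq.
Qed.

(* The birth flux out of [0, ..., n] balances the deaths and catastrophes
   entering it. *)
Lemma steady_flux n : al n * q n = be n.+1 * q n.+1 + xi * Qt n.+1.
Proof.
elim: n => [|n IHn]; have := steady_forward.
  by move=> /(_ 0%N); rewrite /forward/= be0 QtS Qt0 mulr1n; nra.
by move=> /(_ n.+1); rewrite /forward/= mulr0n IHn [Qt n.+2]QtS; nra.
Qed.

Let Qt_ge0 n : 0 <= Qt n.
Proof. by rewrite subr_ge0; exact: nd_sum_ord_le_lim. Qed.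

(** If the tail vanished first at [n.+1], then [q n] would be positive and [q n.+1] zero, and the
    flux balance would give [al n * q n = 0]. Hence the rates of [N^*] have nonzero denominators. *)
Lemma steady_tail_gt0 n : 0 < Qt n.
Proof.
elim: n => [|n IHn]; first by rewrite Qt0.
rewrite lt_neqAle Qt_ge0 andbT; apply/eqP => Q0.
have qn : q n = Qt n by rewrite -[RHS]subr0 Q0 QtS; ring.
have qn1 : q n.+1 = 0.
  apply/eqP; rewrite eq_le q_ge0 andbT -subr_ge0 sub0r.
  by have := Qt_ge0 n.+2; rewrite QtS -Q0 sub0r.
have := steady_flux n; rewrite -Q0 qn1 !mulr0 addr0 => /eqP.
by rewrite mulf_eq0 qn !gt_eqF.
Qed.

Let Qt_gt0 := steady_tail_gt0.
Let alS n := al n * (Qt n / Qt n.+1).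
Let beS n := be n * (Qt n.+1 / Qt n).
Let alS_ge0 n : 0 <= alS n.
Proof. by rewrite mulr_ge0// divr_ge0. Qed.
Let beS_ge0 n : 0 <= beS n.
Proof. by rewrite mulr_ge0// divr_ge0. Qed.
Let beS0 : beS 0%N = 0. Proof. by rewrite /beS be0 mul0r. Qed.
Let HQS := cat_gen_qmatrix alS_ge0 beS_ge0 beS0 (lexx 0).
Let FS := minchain (cat_gen alS beS 0) 0%N.

Context (FS1 : forall t, 0 <= t -> \sum_(k < N) FS k t @[N --> \oo] --> (1 : R)).

Let G n t := 1 - \sum_(k < n) FS k t.
Let w n t := q n * G n t + FS n t * Qt n.+1.

Let is_derive_w n t : 0 < t ->
  is_derive t 1 (w n) (forward al be xi (w ^~ t) 1 n).
Proof.
move=> t0.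
have DF k : is_derive t 1 (FS k) (forward alS beS 0 (FS ^~ t) 1 k).
  exact: forward_equation.
have DG : is_derive t 1 (G n) (0 - \sum_(k < n) forward alS beS 0 (FS ^~ t) 1 k).
  apply: (is_derive_funB (is_derive_const 1 t)).
  by apply: (@is_derive_sum_ord _ n FS (fun k t => forward alS beS 0 (FS ^~ t) 1 k)).
have H := is_derive_funD (is_derive_funZ (q n) DG)
  (is_derive_funM (DF n) (is_derive_const (Qt n.+1) t)).
(* The derivative of the tail [G n] collapses to a single flux. *)
apply: is_derive_eq H _; rewrite sum_forward// sub0r mulr0 addr0.
have GS k : G k.+1 t = G k t - FS k t.
  by rewrite /G big_ord_recr/= opprD addrA.
have Qn0 k : Qt k != 0 by rewrite gt_eqF.
have E k : al k * q k - be k.+1 * q k.+1 - xi * Qt k.+1 = 0.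
  by rewrite steady_flux; ring.
case: n {DG} => [|n].
  rewrite /forward /w !mulr1n mul0r add0r addr0 oppr0 mulr0 beS0 be0.
  apply/eqP; rewrite -subr_eq0; apply/eqP.
  transitivity ((al 0%N * q 0%N - be 1%N * q 1%N - xi * Qt 1) * G 1 t).
    2: by rewrite E mul0r.
  rewrite /alS /beS.
  have := Qn0 1%N; have := Qn0 2; rewrite GS (QtS 1) (QtS 0) Qt0.
  rewrite (_ : G 0 t = 1); last by rewrite /G big_ord0 subr0.
  by move=> h1 h2; field; rewrite ?h1 ?h2.
rewrite /forward/= /w !mulr0n !addr0.
apply/eqP; rewrite -subr_eq0; apply/eqP.
(* The two sides differ by the steady flux balances at [n] and [n.+1], weighted by tails of [N^*];
   both balances vanish. *)
transitivity (- (al n * q n - be n.+1 * q n.+1 - xi * Qt n.+1) * G n.+1 t +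
    (al n.+1 * q n.+1 - be n.+2 * q n.+2 - xi * Qt n.+2) * G n.+2 t).
  2: by rewrite !E oppr0 !mul0r addr0.
rewrite /alS /beS; have := Qn0 n.+1; have := Qn0 n.+2.
rewrite (GS n.+1) (GS n) (QtS n.+2) (QtS n.+1) (QtS n).
by move=> h1 h2; field; rewrite ?h1 ?h2.
Qed.

Let FS_ge0 n t : 0 <= t -> 0 <= FS n t.
Proof. exact: minchain_ge0. Qed.

Let G_ge0 n t : 0 <= t -> 0 <= G n t.
Proof. by move=> t0; rewrite subr_ge0; exact: sum_minchain_le1. Qed.

Let w_ge0 n t : 0 <= t -> 0 <= w n t.
Proof. by move=> t0; rewrite addr_ge0// mulr_ge0// ?G_ge0// FS_ge0. Qed.

Let w0 n : w n 0 = (n == 0%N)%:R.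
Proof.
rewrite /w /G /FS minchain0//; under eq_bigr do rewrite minchain0//.
case: n => [|n]; first by rewrite big_ord0 QtS Qt0 subr0 /=; ring.
by rewrite big_ord_recl/= big1// addr0 subrr mulr0 mul0r addr0.
Qed.

Let w_cvg0 n : w n s @[s --> 0^'+] --> w n 0.
Proof.
have C k : FS k s @[s --> 0^'+] --> FS k 0 by exact: minchain_cvg0.
apply: cvgD; apply: cvgM => //; try exact: cvg_cst.
apply: cvgB; first exact: cvg_cst.
by apply: (@cvg_sum_ord _ _ _ _ n FS (FS ^~ 0)).
Qed.

Let sum_w N t : \sum_(k < N) w k t = 1 - Qt N * G N t.
Proof.
elim: N => [|N IHN]; first by rewrite big_ord0 Qt0 /G big_ord0; ring.
rewrite big_ord_recr/= IHN /w QtS.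
by rewrite (_ : G N.+1 t = G N t - FS N t); [ring|rewrite /G big_ord_recr/=; ring].
Qed.

(** The factor [expR (xi * t)] cancels the loss at rate [xi]; of the catastrophes only the
    nonnegative inflow into 0 remains. *)
Let Fh_le_w n t : 0 <= t -> Fh 0 n t <= expR (xi * t) * w n t.
Proof.
apply: (@minchain_le_super _ _ HQh 0%N (fun n t => expR (xi * t) * w n t)
  (fun n t => xi * expR (xi * t) * w n t +
    expR (xi * t) * forward al be xi (w ^~ t) 1 n)).
- move=> j s s0; apply: is_derive_funM; first exact: is_derive_expRM.
  exact: is_derive_w.
- move=> j m s jm s0.
  rewrite (@cat_gen_col R al be 0 (fun k => expR (xi * s) * w k s))//.
  rewrite -subr_ge0 [leRHS](_ : _ = expR (xi * s) * (xi *+ (j == 0%N))).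
    by rewrite mulr_ge0 ?expR_ge0// mulrn_wge0.
  by rewrite /forward; case: (j) => [|j']; rewrite ?mulr1n ?mulr0n; ring.
- by move=> j; apply: cvgM; [exact: cvg_expRM_at_right0 | exact: w_cvg0].
- by move=> j; rewrite mulr0 expR0 mul1r w0.
- by move=> j s s0; rewrite mulr_ge0 ?expR_ge0// w_ge0.
Qed.

Lemma minchain_decomposition j n t : 0 <= t ->
  F j n t = expR (- (xi * t)) * (Fh j n t - Fh 0 n t) + q n * G n t +
    FS n t * Qt n.+1.
Proof.
rewrite -addrA -/(w n t).
pose v n t := expR (- xi * t) * (Fh j n t - Fh 0 n t) + w n t.
(* In this form both terms of [v] are visibly nonnegative, the second one by [Fh_le_w]. *)
have vE k s : v k s = expR (- xi * s) * Fh j k s +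
    expR (- xi * s) * (expR (xi * s) * w k s - Fh 0 k s).
  rewrite [in RHS]mulrBr [in X in _ + (X - _)]mulrA -expRD.
  by rewrite mulNr addNr expR0 mul1r /v mulNr; ring.
have v_ge0 k s : 0 <= s -> 0 <= v k s.
  move=> s0; rewrite vE addr_ge0// mulr_ge0 ?expR_ge0//.
    exact: minchain_ge0.
  by rewrite subr_ge0 Fh_le_w.
have sum_v s : 0 <= s -> \sum_(k < N) v k s @[N --> \oo] --> (1 : R).
  move=> s0.
  have -> : (fun N => \sum_(k < N) v k s) = (fun N => expR (- xi * s) *
      (\sum_(k < N) Fh j k s - \sum_(k < N) Fh 0 k s) + (1 - Qt N * G N s)).
    by apply/funext => N; rewrite big_split/= sum_w -mulr_sumr sumrB.
  (* The masses of the two birth-death rows cancel, and both tails tend to 0. *)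
  rewrite [X in _ --> X](_ : _ = expR (- xi * s) * (1 - 1) +
    (1 - (1 - 1) * (1 - 1))); last by ring.
  apply: cvgD.
    apply: cvgM; first exact: cvg_cst.
    by apply: cvgB; exact: Fh1.
  apply: cvgB; first exact: cvg_cst.
  apply: cvgM; first by apply: cvgB; [exact: cvg_cst | exact: q1].
  by apply: cvgB; [exact: cvg_cst | exact: FS1].
have sum_v_le1 N s : 0 <= s -> \sum_(k < N) v k s <= 1.
  move=> s0; apply: (@nd_sum_ord_le_lim R (v ^~ s)) (sum_v s s0) => k.
  exact: v_ge0.
have Fh0 i k : Fh i k s @[s --> 0^'+] --> Fh i k 0 by exact: minchain_cvg0.
have DFh i k s : 0 < s ->
    is_derive s 1 (Fh i k) (forward al be 0 (Fh i ^~ s) 1 k).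
  by move=> s0; apply: forward_equation => // x x0; exact: Fh1.
have Fv k s : 0 <= s -> F j k s <= v k s.
  apply: (@minchain_le_super _ _ HQ j v (fun k s =>
    (- xi * expR (- xi * s) * (Fh j k s - Fh 0 k s) + expR (- xi * s) *
      (forward al be 0 (Fh j ^~ s) 1 k - forward al be 0 (Fh 0%N ^~ s) 1 k)) +
    forward al be xi (w ^~ s) 1 k)) => //.
  - move=> i u u0; apply: is_derive_funD; last exact: is_derive_w.
    apply: is_derive_funM; first exact: is_derive_expRM.
    exact: is_derive_funB (DFh j i u u0) (DFh 0%N i u u0).
  - move=> i m u im u0; rewrite (@cat_gen_col R al be xi (v ^~ u))//.
    (* Raising the truncated mass of [v] to 1 turns the inequality into the exact forward
       equation. *)
    apply: le_trans (forward_le_mass al be _ i xi_ge0 (sum_v_le1 m u (ltW u0))) _.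
    rewrite le_eqVlt; apply/orP; left; apply/eqP.
    by rewrite /forward /v; case: (i) => [|i']; rewrite ?mulr1n ?mulr0n; ring.
  - move=> i; apply: cvgD; last exact: w_cvg0.
    apply: cvgM; first exact: cvg_expRM_at_right0.
    by apply: cvgB; exact: Fh0.
  - by move=> i; rewrite /v mulr0 expR0 mul1r w0 /Fh !minchain0// subrK.
move=> t0; rewrite -mulNr -/(v n t).
apply: (@dominated_mass_eq R (F j ^~ t) (v ^~ t) 1 n).
- by move=> k; exact: Fv.
- exact: F1.
- by move=> N; exact: sum_v_le1.
Qed.
End Decomposition.

(* The total mass is nonincreasing in time and, by Fatou, it is at least the
   mass 1 of the limit. *)
Lemma steady_state_nonexplosive (R : realType) (r : nat) (a : nat -> nat -> R)
    (p : nat -> nat -> R -> R) (q : nat -> R) (j : nat) :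
  transition_function r a p -> steady_state r p q -> (r <= j)%N ->
  nonexplosive_from r p j.
Proof.
move=> tp [pq q1] rj s s0.
have p0 i n t : (r <= i)%N -> (r <= n)%N -> 0 <= t -> 0 <= p i n t.
  exact: tf_ge0 tp i n t.
have q0 n : (r <= n)%N -> 0 <= q n.
  move=> rn; apply: (ler_cvg_to (cvg_cst 0) (pq j n rj rn)).
  by exists 0; split => // t /ltW t0; exact: p0.
have qs := (nnseries_cvgP 1 q0).1 q1.
pose S N t := \sum_(n < N) p j (r + n)%N t.
have S1 N t : 0 <= t -> S N t <= 1.
  move=> t0; apply: (@nnseries_partial_le R r (fun n => p j n t)).
    by move=> k rk; exact: p0.
  exact: (tf_le1 tp).
have S_nd : nondecreasing_seq (S ^~ s).
  move=> N M NM; apply: (@sum_ord_le R N M (fun k => p j (r + k)%N s)) => // k _.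
  by rewrite p0// leq_addr.
have Sub : has_ubound (range (S ^~ s)) by exists 1 => _ [N _ <-]; exact: S1.
have Scvg := nondecreasing_cvgn S_nd Sub.
set c := sup (range (S ^~ s)) in Scvg.
have c_le1 : c <= 1 by apply: (cvgn_le Scvg) => N; exact: S1.
(* By Chapman-Kolmogorov each state passes on at most the mass that it carries at time [s]; cutting
   the sum at [K] keeps the exchange of sums finite. *)
have SNc N t : 0 <= t -> S N (s + t) <= c.
  move=> t0.
  have CK n : \sum_(k < K) p j (r + k)%N s * p (r + k)%N (r + n)%N t @[K --> \oo] -->
      p j (r + n)%N (s + t).
    apply/(@nnseries_cvgP R r (fun k => p j k s * p k (r + n)%N t)).
      by move=> k rk; rewrite mulr_ge0// p0// leq_addr.
    by rewrite -(tf_chapman_kolmogorov tp)// leq_addr.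
  have H : \sum_(n < N) \sum_(k < K)
        p j (r + k)%N s * p (r + k)%N (r + n)%N t @[K --> \oo] --> S N (s + t).
    by apply: (@cvg_sum_ord R nat \oo _ N
      (fun n K => \sum_(k < K) p j (r + k)%N s * p (r + k)%N (r + n)%N t)
      (fun n => p j (r + n)%N (s + t))) => n _; exact: CK.
  apply: (cvgn_le H) => K; rewrite exchange_big/=.
  apply: (@le_trans _ _ (S K s)); last first.
    exact: (cvgn_ge (N := K) Scvg (fun M KM => S_nd K M KM)).
  apply: ler_sum => k _; rewrite -mulr_sumr ler_piMr//.
    by rewrite p0// leq_addr.
  apply: (@nnseries_partial_le R r (fun n => p (r + k)%N n t)).
    by move=> n rn; rewrite p0// leq_addr.
  by apply: (tf_le1 tp) => //; exact: leq_addr.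
have c_ge1 : 1 <= c.
  apply: (cvgn_le qs) => N.
  have H : S N t @[t --> +oo] --> \sum_(n < N) q (r + n)%N.
    apply: (@cvg_sum_ord R R (+oo)%R _ N (fun n t => p j (r + n)%N t)
      (fun n => q (r + n)%N)) => n _.
    by apply: pq => //; exact: leq_addr.
  apply: (ler_cvg_to H (cvg_cst c)).
  exists s; split; [exact: num_real|move=> t st].
  have := SNc N (t - s); rewrite subr_ge0 addrC subrK; apply; exact: ltW.
apply/(@nnseries_cvgP R r (fun n => p j n s)); first by move=> k rk; exact: p0.
by have <- : c = 1 by apply/eqP; rewrite eq_le c_le1.
Qed.

(** * Return to the state space starting at [r] *)

Theorem theorem5p2 (R : realType) (r : nat) (alpha beta : nat -> R) (xi : R)
    (halpha : forall n : nat, (r <= n)%N -> 0 < alpha n)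
    (hbeta : forall n : nat, (r < n)%N -> 0 <= beta n)
    (hxi : 0 < xi)
    (p phat pstar : nat -> nat -> R -> R) (q : nat -> R)
    (hp : markov_chain r (catastrophe_rates r alpha beta xi) p)
    (hphat : markov_chain r (birth_death_rates r alpha beta) phat)
    (hphat1 : forall j : nat, (r <= j)%N -> nonexplosive_from r phat j)
    (hq : steady_state r p q)
    (hpstar : markov_chain r
       (birth_death_rates r (alpha_star alpha q) (beta_star beta q)) pstar)
    (hpstar1 : nonexplosive_from r pstar r)
    (t : R) (ht : 0 <= t) (j n : nat) (hj : (r <= j)%N) (hn : (r <= n)%N) :
  p j n t =
    expR (- (xi * t)) * (phat j n t - phat r n t)
    + q n * tail (fun k : nat => pstar r k t) n
    + pstar r n t * tail q n.+1.
Proof.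
have hp1 i : (r <= i)%N -> nonexplosive_from r p i.
  exact: steady_state_nonexplosive hp.1 hq.
have [pq q1] := hq.
have q0 k : (r <= k)%N -> 0 <= q k.
  move=> rk; apply: (ler_cvg_to (cvg_cst 0) (pq r k (leqnn r) rk)).
  by exists 0; split => // s /ltW s0; exact: (tf_ge0 hp.1).
have qs := (nnseries_cvgP 1 q0).1 q1.
pose al i := alpha (r + i)%N.
(* The value 0 encodes the absence of deaths at [r], whatever [beta r] is. *)
pose be i := if i is 0%N then 0 else beta (r + i)%N.
pose q' i := q (r + i)%N.
pose Qt i := 1 - \sum_(k < i) q' k.
have al0 i : 0 < al i by rewrite halpha// leq_addr.
have be_ge0 i : 0 <= be i by case: i => [|i] //=; apply: hbeta; lia.
have tailq i : tail q (r + i)%N = Qt i by rewrite (tailE _ q0 q1).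
have Qt_ge0 i : 0 <= Qt i.
  rewrite subr_ge0; apply: (nd_sum_ord_le_lim (f := q')) qs => k.
  by rewrite /q' q0// leq_addr.
have HQ := cat_gen_qmatrix (fun i => ltW (al0 i)) be_ge0 erefl (ltW hxi).
have HQh := cat_gen_qmatrix (fun i => ltW (al0 i)) be_ge0 erefl (lexx 0).
have gen := generator_cat_gen halpha hbeta (ltW hxi).
have genh := generator_cat_gen halpha hbeta (lexx 0).
have pF i k s : 0 <= s ->
    p (r + i)%N (r + k)%N s = minchain (cat_gen al be xi) i k s.
  by move=> s0; apply: (markov_chain_minchain HQ gen) => //; exact/hp1/leq_addr.
have pFh i k s : 0 <= s ->
    phat (r + i)%N (r + k)%N s = minchain (cat_gen al be 0) i k s.
  by move=> s0; apply: (markov_chain_minchain HQh genh) => //; exact/hphat1/leq_addr.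
have F1 i s : 0 <= s ->
    \sum_(k < N) minchain (cat_gen al be xi) i k s @[N --> \oo] --> (1 : R).
  move=> s0; under eq_fun do under eq_bigr do rewrite -pF//.
  apply/(@nnseries_cvgP R r (fun k => p (r + i)%N k s)).
    by move=> k rk; rewrite (tf_ge0 hp.1)// leq_addr.
  by apply: hp1 => //; exact: leq_addr.
have Fh1 i s : 0 <= s ->
    \sum_(k < N) minchain (cat_gen al be 0) i k s @[N --> \oo] --> (1 : R).
  move=> s0; under eq_fun do under eq_bigr do rewrite -pFh//.
  apply/(@nnseries_cvgP R r (fun k => phat (r + i)%N k s)).
    by move=> k rk; rewrite (tf_ge0 hphat.1)// leq_addr.
  by apply: hphat1 => //; exact: leq_addr.
have Fq k : minchain (cat_gen al be xi) 0 k s @[s --> +oo] --> q' k.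
  have := pq (r + 0)%N (r + k)%N (leq_addr 0 r) (leq_addr k r).
  apply: cvg_trans; apply: near_eq_cvg.
  by exists 0; split => // s /ltW s0; rewrite pF.
have q'0 k : 0 <= q' k by rewrite q0// leq_addr.
(* Positive tails make the starred rates admissible for [generator_cat_gen]. *)
have Qt_gt0 k : 0 < Qt k.
  exact: (steady_tail_gt0 al0 be_ge0 erefl hxi q'0 qs F1 Fq).
pose alS i := al i * (Qt i / Qt i.+1).
pose beS i := be i * (Qt i.+1 / Qt i).
have alSE i : alpha_star alpha q (r + i)%N = alS i.
  by rewrite /alpha_star -addnS !tailq.
have beSE i : beta_star beta q (r + i.+1)%N = beS i.+1.
  by rewrite /beta_star -[(r + _).+1]addnS !tailq.
have alS0 k : (r <= k)%N -> 0 < alpha_star alpha q k.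
  by move=> rk; rewrite -(subnKC rk) alSE mulr_gt0// divr_gt0.
have beS0 k : (r < k)%N -> 0 <= beta_star beta q k.
  move=> rk; rewrite -(subnKC rk) addSnnS beSE mulr_ge0// divr_ge0// ltW//.
have genS := generator_cat_gen alS0 beS0 (lexx 0).
rewrite (_ : (fun i => alpha_star _ _ _) = alS) in genS; last exact/funext.
rewrite (_ : (fun i => if i is _.+1 then _ else _) = beS) in genS; last first.
  by apply/funext => -[|i] //; rewrite /beS mul0r.
have alS_ge0 i : 0 <= alS i by rewrite -alSE ltW// alS0// leq_addr.
have beS_ge0 i : 0 <= beS i.
  by case: i => [|i]; rewrite ?/beS ?mul0r// -/(beS _) -beSE beS0//; lia.
have HQS : qmatrix (cat_gen alS beS 0).
  by apply: cat_gen_qmatrix => //; rewrite /beS mul0r.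
have pFS k s : 0 <= s ->
    pstar r (r + k)%N s = minchain (cat_gen alS beS 0) 0 k s.
  move=> s0; rewrite -[X in pstar X](addn0 r).
  by apply: (markov_chain_minchain HQS genS) => //; rewrite addn0.
have FS1 s : 0 <= s ->
    \sum_(k < N) minchain (cat_gen alS beS 0) 0 k s @[N --> \oo] --> (1 : R).
  move=> s0; under eq_fun do under eq_bigr do rewrite -pFS//.
  apply/(@nnseries_cvgP R r (fun k => pstar r k s)); last exact: hpstar1.
  by move=> k rk; rewrite (tf_ge0 hpstar.1).
rewrite -(subnKC hj) -(subnKC hn) -addnS tailq.
rewrite (@tailE R r (fun k => pstar r k t) 1 (n - r)); last 2 first.
- by move=> k rk; rewrite (tf_ge0 hpstar.1).
- exact: hpstar1.
under eq_bigr do rewrite pFS//.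
have := pFh 0%N (n - r)%N t ht; rewrite addn0 => ->.
rewrite pF// pFh// pFS//.
exact: (minchain_decomposition al0 be_ge0 erefl hxi q'0 qs F1 Fh1 Fq FS1).
Qed.
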